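(* For every $\alpha \in (0,1)$ the limit $$\lim_{n\to\infty} \frac1n \log \sup_{\deg p \le \alpha n} \frac{\|p\|_{[-1,1]}}{\|p\|_{E_n}}$$ exists and is equal to $$C(\alpha) = \frac{(1+\alpha)\log(1+\alpha) + (1-\alpha)\log(1-\alpha)}{2},$$ where for each $n$ the supremum is over all univariate polynomials $p$ of degree at most $\alpha n$ that do not vanish identically.
   Context: For an integer $n\ge 2$, the $n$-grid is $E_n = \{\xi_{k,n} = \frac{2k-n-1}{n-1} : k=1,\dots,n\}$, i.e. $n$ equally spaced points in $[-1,1]$ including $\pm1$. For a set $K\subset\mathbb R$, $\|p\|_K = \sup_{x\in K}|p(x)|$. Polynomials have complex coefficients. Since $\alpha<1$, a nonzero polynomial of degree at most $\alpha n$ cannot vanish at all points of $E_n$, so the ratio is well defined. *)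

(* Defs.v *)
From HB Require Import structures.
From mathcomp Require Import all_boot all_order all_algebra.
From mathcomp Require Import all_classical all_reals all_analysis.
From mathcomp Require Import complex.
Set Implicit Arguments.
Unset Strict Implicit.
Unset Printing Implicit Defensive.
Import Order.TTheory GRing.Theory Num.Theory.
Import numFieldNormedType.Exports.
Local Open Scope classical_set_scope.
Local Open Scope ring_scope.

Definition grid_point (R : realType) (n k : nat) : R :=
  (2 * k%:R - n%:R - 1) / (n%:R - 1).

Definition grid (R : realType) (n : nat) : set R :=
  [set grid_point R n k | k in [set k : nat | (1 <= k <= n)%N]].
Arguments grid : clear implicits.

(* [normc] is the real-valued modulus: the norm of [R[i]] itself takes its
   values in [R[i]] and is [z |-> (normc z)%:C].  The real [sup] is the true
   supremum only on nonempty bounded sets of values, hence for nonempty bounded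
   [K]; the sets of interest are [`[-1, 1]] and [grid R n] with [n >= 2]. *)
Definition supnorm (R : realType) (K : set R) (p : {poly R[i]}) : R :=
  sup [set ComplexField.Normc.normc p.[(x%:C)%C] | x in K].

(* [(size p).-1] is the degree of [p]. *)
Definition nonzero_polys_deg_le (R : realType) (d : R) : set {poly R[i]} :=
  [set p : {poly R[i]} | p != 0 /\ ((size p).-1)%:R <= d].

(* The outer supremum is taken in the extended reals, so its finiteness is not
   presupposed. For [0 < alpha < 1] and [n >= 2] the denominator is nonzero. *)
Definition max_ratio (R : realType) (alpha : R) (n : nat) : \bar R :=
  ereal_sup [set (supnorm `[-1, 1]%classic p / supnorm (grid R n) p)%:E
            | p in nonzero_polys_deg_le (alpha * n%:R)].

Definition growth_rate (R : realType) (alpha : R) : R :=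
  ((1 + alpha) * ln (1 + alpha) + (1 - alpha) * ln (1 - alpha)) / 2.

(* Main.v *)
(* The extremal polynomials are, up to subexponential factors, the discrete
   Chebyshev (Gram) polynomials [u_d], orthogonal on the grid {0, ..., m} with
   m = n - 1.  They are explicit: [u_d(-1) = 'C(m + 1 + d, d)], the square of
   their l^2 norm on the grid is [h_d = 'C(2d, d) 'C(m + 1 + d, 2d + 1)], and
   Stirling's formula shows that [u_d(-1) / sqrt h_d] grows like
   [exp (n C(d / n))].

   Upper bound.  A polynomial that is small on the grid has small coefficients
   in the basis [u_j], so it is enough to show that [|u_j|] is at most
   [max (2 sqrt h_j) |u_j(-1)|] on [0, m].  Let z be a point where [|u_j|] is
   maximal over [-1, m + 1].  If z is outside ]0, m[, then [|u_j(z)|] is at most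
   [|u_j(-1)|], from the explicit formula and the symmetry about m / 2.
   Otherwise, the second order difference equation of [u_j], read at z, forces z
   to lie so far from the endpoints that Bernstein's inequality applies on the
   scale of the mesh: the grid point nearest to z carries at least half of the
   maximum, and values on the grid are at most [sqrt h_j].

   Lower bound.  The polynomial [x * u(x - 1)], with u a Gram polynomial on one
   point fewer, is controlled on the grid and of size about [u(-1)] at
   x = 1 / 2. *)

Require Import Defs.
From HB Require Import structures.
From mathcomp Require Import all_boot all_order all_algebra.
From mathcomp Require Import all_classical all_reals all_analysis.
From mathcomp Require Import complex.
From mathcomp Require Import ring lra zify.
Set Implicit Arguments.
Unset Strict Implicit.
Unset Printing Implicit Defensive.
Import Order.TTheory GRing.Theory Num.Theory.
Import numFieldNormedType.Exports.
Local Open Scope classical_set_scope.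
Local Open Scope ring_scope.

(** * Binomial sums and binomial polynomials *)

(** Both sides count the subsets of {0, ..., n} with p + q + 1 elements, x being the element of rank
    p + 1. *)
Lemma sum_bin_convolution (n p q : nat) :
  (\sum_(x < n.+1) 'C(x, p) * 'C(n - x, q) = 'C(n.+1, p + q.+1))%N.
Proof.
elim: n p q => [|n IHn] p q.
  by rewrite big_ord1 subnn addnS binS !bin0n addn_eq0 mulnb; case: (p == 0%N).
case: q => [|q].
  rewrite addn1 binS; have := IHn p 0%N; rewrite addn1 => <-.
  rewrite big_ord_recr /= subnn muln1.
  by congr addn; apply: eq_bigr => x _; rewrite !bin0.
rewrite big_ord_recr /= subnn muln0 addn0 addnS binS -(addnS p) -!IHn.
rewrite -big_split /=; apply: eq_bigr => x _.
by rewrite subSn -1?ltnS // binS mulnDr.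
Qed.

(** The left side is the value of the Gram polynomial at -1. It is a convolution of ['C(x, d)] and
    ['C(m + d - x, m - d)], a product that vanishes unless d <= x <= 2 d; there x = d + k. *)
Lemma sum_bin_multiset (m d : nat) : (d <= m)%N ->
  (\sum_(k < d.+1) 'C(m - k, d - k) * 'C(d + k, d) = 'C(m.+1 + d, d))%N.
Proof.
move=> le_dm.
have := sum_bin_convolution (m + d) d (m - d).
rewrite addnS subnKC // -(@bin_sub _ d) ?leq_addl // addSn.
have -> : ((m + d).+1 - d = m.+1)%N by lia.
move=> <-; apply/esym.
rewrite -(@big_mkord _ _ _ (m + d).+1 predT
  (fun x => ('C(x, d) * 'C(m + d - x, m - d))%N)).
rewrite (@big_cat_nat _ _ _ d) //=; last by lia.
rewrite big_nat big1 ?add0n => [|x /andP[_ xd]]; last by rewrite bin_small.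
rewrite (@big_cat_nat _ _ _ (d + d).+1) //=; [|lia|lia].
rewrite addnC big_nat big1 ?add0n => [|x /andP[lx ux]]; last first.
  by rewrite (@bin_small _ (m - d)) ?muln0 //; lia.
rewrite -[d in X in X = _]add0n big_addn.
have -> : ((d + d).+1 - d = d.+1)%N by lia.
rewrite big_mkord; apply: eq_bigr => k _; rewrite mulnC [(d + k)%N]addnC.
have -> : (m + d - (k + d) = m - k)%N by lia.
congr (_ * _)%N; have kd := ltn_ord k.
by rewrite -bin_sub; [congr 'C(_, _); lia | lia].
Qed.

Section BinomialPolynomials.
Variable R : realFieldType.
Implicit Types (x : R) (k : nat).

Definition binom_poly k : {poly R} :=
  (k`!%:R)^-1 *: \prod_(i < k) ('X - (i%:R)%:P).

Lemma factS_neq0 k : (k.+1%:R : R) != 0.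
Proof. by rewrite pnatr_eq0. Qed.

Lemma horner_binom_poly k x :
  (binom_poly k).[x] = (k`!%:R)^-1 * \prod_(i < k) (x - i%:R).
Proof.
rewrite hornerZ horner_prod; congr (_ * _).
by apply: eq_bigr => i _; rewrite hornerXsubC.
Qed.

Lemma binom_poly0 x : (binom_poly 0).[x] = 1.
Proof. by rewrite horner_binom_poly big_ord0 invr1 mulr1. Qed.

Lemma binom_polyS k x :
  k.+1%:R * (binom_poly k.+1).[x] = (x - k%:R) * (binom_poly k).[x].
Proof.
rewrite !horner_binom_poly big_ord_recr /= factS natrM invfM.
by rewrite !mulrA divff ?factS_neq0 // mul1r; ring.
Qed.

Lemma binom_polyS_shift k x :
  k.+1%:R * (binom_poly k.+1).[x] = x * (binom_poly k).[x - 1].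
Proof.
rewrite !horner_binom_poly big_ord_recl /= factS natrM invfM subr0.
rewrite !mulrA divff ?factS_neq0 // mul1r [in RHS](mulrC x) -!mulrA.
congr (_ * (_ * _)); apply: eq_bigr => i _.
by rewrite /bump add1n -natr1; ring.
Qed.

Lemma binom_poly_pascal k x :
  (binom_poly k.+1).[x + 1] = (binom_poly k.+1).[x] + (binom_poly k).[x].
Proof.
apply: (mulfI (factS_neq0 k)); rewrite [RHS]mulrDr binom_polyS_shift addrK.
by rewrite binom_polyS -natr1; ring.
Qed.

Lemma binom_poly_nat k n : (binom_poly k).[n%:R] = 'C(n, k)%:R.
Proof.
elim: n k => [|n IHn] [|k]; rewrite ?binom_poly0 ?bin0 //.
  by apply: (mulfI (factS_neq0 k)); rewrite binom_polyS_shift mul0r bin0n mulr0.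
by rewrite -natr1 binom_poly_pascal !IHn -natrD binS.
Qed.

Lemma size_binom_poly k : size (binom_poly k) = k.+1.
Proof.
rewrite size_scale ?invr_eq0 ?pnatr_eq0 -?lt0n ?fact_gt0 //.
rewrite -(big_mkord predT (fun i => 'X - (i%:R)%:P)).
by rewrite size_prod_XsubC size_iota subn0.
Qed.

Lemma lead_coef_binom_poly k : lead_coef (binom_poly k) = (k`!%:R)^-1.
Proof.
by rewrite lead_coefZ (monicP _) ?mulr1 ?monic_prod_XsubC.
Qed.

End BinomialPolynomials.

Arguments binom_poly R k : clear implicits.

(** * Gram polynomials and their difference equation *)

(** Up to the sign (-1)^k, the coefficient of the discrete Chebyshev polynomial on the binomial
    polynomial of degree k; meant for k <= d <= m. *)
Definition gram_coef (m d k : nat) : nat := ('C(m - k, d - k) * 'C(d + k, d))%N.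

(** This two-term recurrence is what the eigenvalue equation of [gram] imposes on its
    coefficients. *)
Lemma gram_coefS m d k : (k < d)%N -> (d <= m)%N ->
  (gram_coef m d k.+1 * (k.+1 * (m - k)) =
   (d - k) * (d + k).+1 * gram_coef m d k)%N.
Proof.
move=> lt_kd le_dm; rewrite /gram_coef.
have e1 : ((m - k) * 'C(m - k.+1, d - k.+1) = (d - k) * 'C(m - k, d - k))%N.
  by rewrite subnS mul_bin_diag -subSn ?subSS.
have e2 : (k.+1 * 'C(d + k.+1, d) = (d + k).+1 * 'C(d + k, d))%N.
  by have := mul_bin_down (d + k).+1 d; rewrite addnS /= -addnS addKn addnS => ->.
transitivity (((m - k) * 'C(m - k.+1, d - k.+1)) * (k.+1 * 'C(d + k.+1, d)))%N.
  by ring.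
by rewrite e1 e2; ring.
Qed.

Section GramPolynomials.
Variable R : realFieldType.
Implicit Types (x : R) (k m d : nat) (p q : {poly R}).

(** The difference operator of the Hahn polynomials with uniform weight, a discrete Legendre
    operator. With D(x) = x (m + 1 - x) its coefficients are D(x + 1) and D(x); since D vanishes at
    0 and m + 1, values off the grid do not enter at the points 0, ..., m. *)
Definition hahn_op m (f : R -> R) x : R :=
  (x + 1) * (m%:R - x) * (f (x + 1) - f x)
  - x * (m.+1%:R - x) * (f x - f (x - 1)).

Lemma hahn_op_sum m n (c : nat -> R) (p : nat -> {poly R}) x :
  hahn_op m (horner (\sum_(k < n) c k *: p k)) x =
  \sum_(k < n) c k * hahn_op m (horner (p k)) x.
Proof.
rewrite /hahn_op !horner_sum -!sumrB !mulr_sumr -sumrB.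
by apply: eq_bigr => k _; rewrite !hornerZ; ring.
Qed.

(** The operator is bidiagonal in the binomial basis, with diagonal entries - k (k + 1). At k = 0
    the truncated index [k.-1] is harmless, its coefficient being 0. *)
Lemma hahn_op_binom m k x : hahn_op m (horner (binom_poly R k)) x =
  k%:R * (m.+1%:R - k%:R) * (binom_poly R k.-1).[x]
  - k%:R * k.+1%:R * (binom_poly R k).[x].
Proof.
case: k => [|k]; rewrite /hahn_op /=.
  by rewrite !binom_poly0; ring.
have := binom_poly_pascal k (x - 1); rewrite subrK => e0.
rewrite binom_poly_pascal.
have := binom_polyS k x; have := binom_polyS_shift k x.
set f := (binom_poly R k.+1).[x]; set g := (binom_poly R k).[x].
set g' := (binom_poly R k).[x - 1] => e1 e2.
set f' := (binom_poly R k.+1).[x - 1].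
have -> : (x + 1) * (m%:R - x) * (f + g - f)
    - x * (m.+1%:R - x) * (f - f') =
  ((x - k%:R) * g + (k%:R + 1) * g) * (m%:R - x) - (x * g') * (m.+1%:R - x).
  have -> : f - f' = g' by rewrite /f /f' /g' e0; ring.
  by ring.
rewrite -e1 -e2.
transitivity (k.+1%:R * ((m%:R - k%:R) * g - (x - k%:R) * g - f)).
  by rewrite -!natr1; ring.
by rewrite -e2 -!natr1; ring.
Qed.

(* The discrete Chebyshev polynomial [u_d]; its argument is the index, in
   {0, ..., m}, of a grid point. *)
Definition gram m d : {poly R} :=
  \sum_(k < d.+1) ((-1) ^+ k * (gram_coef m d k)%:R) *: binom_poly R k.

Lemma hahn_op_gram m d x : (d <= m)%N ->
  hahn_op m (horner (gram m d)) x = - (d * d.+1)%:R * (gram m d).[x].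
Proof.
move=> le_dm; rewrite /gram.
rewrite (hahn_op_sum m d.+1 (fun k => (-1) ^+ k * (gram_coef m d k)%:R)).
under eq_bigr => k _ do rewrite hahn_op_binom mulrBr.
rewrite sumrB big_ord_recl /= !mul0r mulr0 add0r horner_sum mulr_sumr.
(* The off-diagonal terms, reindexed by [gram_coefS], join the diagonal ones; then (d - k) (d + k +
   1) + k (k + 1) = d (d + 1). The added term k = d is 0. *)
rewrite (_ : \sum_(i < d) _ = \sum_(k < d.+1) - ((d - k) * (d + k).+1)%:R *
   (((-1) ^+ k * (gram_coef m d k)%:R) * (binom_poly R k).[x])); last first.
  rewrite big_ord_recr /= subnn mul0n oppr0 mul0r addr0; apply: eq_bigr => k _.
  have := gram_coefS (ltn_ord k) le_dm.
  rewrite /bump add1n add0n.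
  move/(congr1 (fun n => n%:R : R)); rewrite natrM natrM.
  rewrite natrB; last by apply: leq_trans le_dm; apply: ltnW.
  move=> e; rewrite exprS.
  transitivity (- ((-1) ^+ k * ((gram_coef m d k.+1)%:R *
     (k.+1%:R * (m%:R - k%:R))) * (binom_poly R k).[x])).
    by rewrite -!natr1; ring.
  by rewrite e [in LHS]natrM; ring.
rewrite -sumrB; apply: eq_bigr => k _.
have kd : (k <= d)%N by rewrite -ltnS.
move: (_ * (gram_coef m d k)%:R) => c.
by rewrite (hornerZ c) !natrM natrB // -!natr1 natrD; ring.
Qed.

Lemma gram_top m d : (d <= m)%N ->
  size (gram m d) = d.+1 /\
  lead_coef (gram m d) = (-1) ^+ d * 'C(d + d, d)%:R / d`!%:R.
Proof.
move=> le_dm; rewrite /gram big_ord_recr /= addrC.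
rewrite /gram_coef subnn bin0 mul1n.
have h : size (((-1) ^+ d * 'C(d + d, d)%:R : R) *: binom_poly R d) = d.+1.
  rewrite size_scale ?size_binom_poly // mulf_neq0 ?signr_eq0 //.
  by rewrite pnatr_eq0 -lt0n bin_gt0 leq_addr.
set low := \sum_(i < d) _.
have hlow : (size low < d.+1)%N.
  rewrite ltnS; apply: (leq_trans (size_sum _ _ _)).
  apply/bigmax_leqP => i _; apply: leq_trans (size_scale_leq _ _) _.
  by rewrite size_binom_poly.
by rewrite size_polyDl ?lead_coefDl ?h // lead_coefZ lead_coef_binom_poly.
Qed.

Lemma size_gram m d : (d <= m)%N -> size (gram m d) = d.+1.
Proof. by case/gram_top. Qed.

End GramPolynomials.

(** * Orthogonality on the grid, norms, and reflection symmetry *)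

Section GramOrthogonality.
Variable R : realFieldType.
Implicit Types (x : R) (k m n d : nat) (p q : {poly R}).

Definition reflect_poly (a : R) p := p \Po (a%:P - 'X).

Lemma horner_reflect_poly a p x : (reflect_poly a p).[x] = p.[a - x].
Proof. by rewrite horner_comp !hornerE. Qed.

Lemma reflect_poly_top a p : size (reflect_poly a p) = size p /\
  lead_coef (reflect_poly a p) = (-1) ^+ (size p).-1 * lead_coef p.
Proof.
rewrite /reflect_poly addrC.
have szC : (size a%:P < size (- 'X : {poly R}))%N.
  by rewrite size_polyN size_polyX size_polyC; case: (_ == _).
have sz : size (- 'X + a%:P) = 2%N by rewrite size_polyDl // size_polyN size_polyX.
rewrite size_comp_poly2 // lead_coef_comp ?sz // lead_coefDl //.
by rewrite lead_coefN lead_coefX mulrC.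
Qed.

Lemma size_sub_same_lead n p q : (size p <= n.+1)%N -> (size q <= n.+1)%N ->
  p`_n = q`_n -> (size (p - q)%R <= n)%N.
Proof.
move=> sp sq e; apply/leq_sizeP => j; rewrite leq_eqVlt coefB.
case/predU1P => [<-|lt_nj]; first by rewrite e subrr.
by rewrite !nth_default ?subrr // (leq_trans _ lt_nj).
Qed.

Definition grid_dot m p q : R := \sum_(i < m.+1) p.[i%:R] * q.[i%:R].

Lemma grid_dotC m p q : grid_dot m p q = grid_dot m q p.
Proof. by apply: eq_bigr => i _; rewrite mulrC. Qed.

(** Summation by parts: the difference of the summands telescopes along the discrete Wronskian [V],
    which vanishes at 0 and m + 1. *)
Lemma hahn_op_selfadjoint m (f g : R -> R) :
  \sum_(i < m.+1) hahn_op m f i%:R * g i%:R =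
  \sum_(i < m.+1) f i%:R * hahn_op m g i%:R.
Proof.
apply/eqP; rewrite -subr_eq0 -sumrB; apply/eqP.
pose V n : R := n%:R * (m.+1%:R - n%:R) *
  (f n%:R * g (n%:R - 1) - g n%:R * f (n%:R - 1)).
rewrite (eq_bigr (fun i : 'I_m.+1 => V i.+1 - V i)) => [|i _]; last first.
  by rewrite /V /hahn_op -[i.+1%:R]natr1 addrK -natr1; ring.
rewrite -(big_mkord predT (fun i => V i.+1 - V i)) telescope_sumr //.
by rewrite /V subrr mulr0 mul0r mul0r mul0r subrr.
Qed.

Definition hahn_eigen m d p :=
  forall x, hahn_op m (horner p) x = - (d * d.+1)%:R * p.[x].

Lemma hahn_eigen_orthogonal m d e p q :
  hahn_eigen m d p -> hahn_eigen m e q -> d != e -> grid_dot m p q = 0.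
Proof.
move=> hp hq neq_de; have := hahn_op_selfadjoint m (horner p) (horner q).
under eq_bigr => i _ do rewrite hp -mulrA.
under [in RHS]eq_bigr => i _ do rewrite hq mulrCA.
rewrite -!mulr_sumr => /eqP; rewrite -subr_eq0 -mulrBl mulf_eq0 => /orP[|/eqP//].
rewrite opprK addrC subr_eq0 eqr_nat => /eqP h.
by case/eqP: neq_de; nia.
Qed.

Lemma gram_basis m n p : (n <= m.+1)%N -> (size p <= n)%N ->
  exists c : nat -> R, p = \sum_(k < n) c k *: gram R m k.
Proof.
elim: n p => [|n IHn] p le_nm le_pn.
  exists (fun=> 0); rewrite big_ord0; apply/eqP.
  by rewrite -size_poly_leq0.
have sg := @size_gram R m n le_nm.
have nz : (gram R m n)`_n != 0.
  by have := lead_coef_eq0 (gram R m n); rewrite lead_coefE sg -size_poly_eq0 sg => ->.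
pose a := p`_n / (gram R m n)`_n.
have [||c hc] := IHn (p - a *: gram R m n); first exact: ltnW.
  apply: size_sub_same_lead => //; last by rewrite coefZ divfK.
  by rewrite (leq_trans (size_scale_leq _ _)) ?sg.
exists (fun k => if k == n then a else c k).
rewrite big_ord_recr /= eqxx -[LHS](subrK (a *: gram R m n)) hc.
by congr (_ + _); apply: eq_bigr => i _; rewrite ltn_eqF.
Qed.

Lemma grid_dot_suml m n (c : nat -> R) (p : nat -> {poly R}) q :
  grid_dot m (\sum_(k < n) c k *: p k) q = \sum_(k < n) c k * grid_dot m (p k) q.
Proof.
rewrite /grid_dot; under eq_bigr => i _ do rewrite horner_sum mulr_suml.
rewrite exchange_big; apply: eq_bigr => k _; rewrite mulr_sumr.
by apply: eq_bigr => i _; rewrite hornerZ mulrA.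
Qed.

(** For j < n this extracts a coefficient; for j >= n it is orthogonality of [gram R m j] to lower
    degrees. *)
Lemma grid_dot_gram_basis m n (c : nat -> R) j : (n <= m.+1)%N -> (j <= m)%N ->
  grid_dot m (\sum_(k < n) c k *: gram R m k) (gram R m j) =
  if (j < n)%N then c j * grid_dot m (gram R m j) (gram R m j) else 0.
Proof.
move=> le_nm le_jm; rewrite grid_dot_suml.
have off (k : 'I_n) : (k : nat) != j ->
    c k * grid_dot m (gram R m k) (gram R m j) = 0.
  move=> neq_kj; rewrite (@hahn_eigen_orthogonal _ k j) ?mulr0 //.
    by move=> x; apply: hahn_op_gram; rewrite -ltnS; apply: leq_trans le_nm.
  by move=> x; apply: hahn_op_gram.
case: ltnP => [lt_jn|le_nj]; last first.
  by apply: big1 => k _; rewrite off // ltn_eqF // (leq_trans _ le_nj).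
by rewrite (bigD1 (Ordinal lt_jn)) //= [X in _ + X]big1 ?addr0.
Qed.

Lemma sum_alternating_bin_rec d (f : nat -> R) :
  \sum_(k < d.+2) (-1) ^+ k * 'C(d.+1, k)%:R * f k =
  \sum_(k < d.+1) (-1) ^+ k * 'C(d, k)%:R * f k -
  \sum_(k < d.+1) (-1) ^+ k * 'C(d, k)%:R * f k.+1.
Proof.
rewrite big_ord_recl [in RHS]big_ord_recl /= -addrA !bin0; congr (_ + _).
under eq_bigr => k _ do rewrite /bump add1n binS natrD mulrDr mulrDl.
rewrite big_split /= big_ord_recr /= bin_small // mulr0 mul0r addr0.
congr (_ + _); rewrite -sumrN; apply: eq_bigr => k _.
by rewrite exprS; ring.
Qed.

(** Both sides equal the Beta integral of x^a (1 - x)^d over [0, 1]; Pascal's rule gives an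
    induction on d, for all a at once. *)
Lemma sum_alternating_bin_inv d a :
  \sum_(k < d.+1) (-1) ^+ k * 'C(d, k)%:R * ((k + a).+1%:R^-1 : R) =
  (d`! * a`!)%:R / ((d + a).+1)`!%:R.
Proof.
elim: d a => [|d IHd] a.
  rewrite big_ord1 bin0 expr0 !mul1r mul1n !add0n factS natrM invfM mulrCA.
  by rewrite mulfV ?mulr1 // pnatr_eq0 -lt0n fact_gt0.
rewrite (sum_alternating_bin_rec d (fun k => (k + a).+1%:R^-1)) IHd.
under eq_bigr => k _ do rewrite addSnnS.
rewrite IHd addnS !addSn !(factS, natrM) invfM.
have nz : ((d + a)`!%:R : R) != 0 by rewrite pnatr_eq0 -lt0n fact_gt0.
have n1 : ((d + a).+1%:R : R) != 0 by rewrite pnatr_eq0.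
have n2 : ((d + a).+2%:R : R) != 0 by rewrite pnatr_eq0.
have e : (d + a).+2%:R = d.+1%:R + a.+1%:R :> R by rewrite -natrD addSn addnS.
move: nz n1 n2; rewrite e.
move: (_`!%:R) (_.+1%:R) (d.+1%:R) (a.+1%:R) (d`!%:R) (a`!%:R) => A u p q D B.
by move=> nz n1 n2; field; rewrite nz n1 n2.
Qed.

(** Up to factors free of k, this brings the terms of the norm computation to the form ['C(d, k)] /
    (k + d + 1) of the preceding alternating sum. *)
Lemma bin_prod_fact m d k : (k <= d)%N -> (d <= m)%N ->
  (gram_coef m d k * 'C((m + d).+1, k + d.+1) * (k + d).+1 *
     ((m - d)`! * d`! * d`!) = ((m + d).+1)`! * 'C(d, k))%N.
Proof.
move=> le_kd le_dm; rewrite /gram_coef.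
have e1 : ('C(m - k, d - k) * ((d - k)`! * (m - d)`!) = (m - k)`!)%N.
  by rewrite -(@bin_fact (m - k) (d - k)) //; [congr (_ * (_ * _`!))%N; lia | lia].
have e2 : ('C(d + k, d) * (d`! * k`!) = (d + k)`!)%N.
  by rewrite -(@bin_fact (d + k) d) ?leq_addr // addKn.
have e3 : ('C((m + d).+1, k + d.+1) * ((d + k).+1 * (d + k)`! * (m - k)`!) =
    ((m + d).+1)`!)%N.
  rewrite -factS -(@bin_fact (m + d).+1 (k + d.+1)); last by lia.
  by congr (_ * (_`! * _`!))%N; lia.
have e4 : ('C(d, k) * (k`! * (d - k)`!) = d`!)%N by rewrite bin_fact.
have p0 : (0 < k`! * (d - k)`!)%N by rewrite muln_gt0 !fact_gt0.
apply/eqP; rewrite -(eqn_pmul2r p0) -[X in _ == X]mulnA e4 -e3 -e1 -e2 -e4.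
by apply/eqP; rewrite (addnC k d); ring.
Qed.

(** By orthogonality to lower degrees, one factor may be replaced by ['C(d + d, d)] times [g], which
    has the same leading term. The choice g(x) = binomial(m + d - x, d) makes the products with
    binomial polynomials summable by [sum_bin_convolution]. *)
Lemma grid_dot_gram m d : (d <= m)%N ->
  grid_dot m (gram R m d) (gram R m d) = ('C(d + d, d) * 'C((m + d).+1, (d + d).+1))%:R.
Proof.
move=> le_dm.
pose g := reflect_poly (m + d)%:R (binom_poly R d).
have hg i : (i <= m)%N -> g.[i%:R] = 'C(m + d - i, d)%:R.
  move=> le_im; rewrite horner_reflect_poly -natrB ?binom_poly_nat //.
  exact: leq_trans (leq_addr _ _).
have dot_g : grid_dot m (gram R m d) g = 'C((m + d).+1, (d + d).+1)%:R.
  rewrite /gram (grid_dot_suml _ _ (fun k => (-1) ^+ k * (gram_coef m d k)%:R)).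
  have F0 n : (n`!%:R : R) != 0 by rewrite pnatr_eq0 -lt0n fact_gt0.
  transitivity (((m + d).+1)`!%:R / ((m - d)`! * d`! * d`!)%:R *
     \sum_(k < d.+1) (-1) ^+ k * 'C(d, k)%:R * ((k + d).+1%:R^-1 : R)).
    rewrite mulr_sumr; apply: eq_bigr => k _.
    have -> : grid_dot m (binom_poly R k) g = 'C((m + d).+1, k + d.+1)%:R.
      rewrite -sum_bin_convolution /grid_dot natr_sum.
      rewrite -(big_mkord predT
        (fun i => (binom_poly R k).[i%:R] * g.[i%:R])).
      rewrite -(big_mkord predT (fun i => ('C(i, k) * 'C(m + d - i, d))%:R : R)).
      (* The convolution runs up to m + d, but ['C(m + d - i, d)] is 0 for i > m. *)
      rewrite [RHS](@big_cat_nat _ _ _ m.+1) //=; last by rewrite ltnS leq_addr.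
      rewrite [X in _ = _ + X]big_nat [X in _ = _ + X]big1 ?addr0.
        apply: eq_big_nat => i /andP[_ lt_im].
        by rewrite binom_poly_nat hg // natrM.
      move=> i /andP[lt_mi le_i]; rewrite (@bin_small (m + d - i)) ?muln0 //.
      lia.
    have kd : (k <= d)%N by rewrite -ltnS.
    have nz : ((k + d).+1 * ((m - d)`! * d`! * d`!))%:R != 0 :> R.
      by rewrite pnatr_eq0 -lt0n !muln_gt0 !fact_gt0.
    have e : (gram_coef m d k)%:R * 'C((m + d).+1, k + d.+1)%:R =
        ((m + d).+1)`!%:R * 'C(d, k)%:R /
        ((k + d).+1 * ((m - d)`! * d`! * d`!))%:R :> R.
      by apply: (canRL (mulfK nz)); rewrite -!natrM mulnA bin_prod_fact.
    by rewrite -[LHS]mulrA e [(_ * (_ * _ * _))%:R]natrM invfM; ring.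
  rewrite sum_alternating_bin_inv.
  have nz : ((m - d)`! * d`! * d`! * ((d + d).+1)`!)%:R != 0 :> R.
    by rewrite pnatr_eq0 -lt0n !muln_gt0 !fact_gt0.
  rewrite mulf_div -!natrM; apply: (canLR (mulfK nz)); rewrite -natrM.
  rewrite -(@bin_fact (m + d).+1 (d + d).+1); last by lia.
  have -> : ((m + d).+1 - (d + d).+1 = m - d)%N by lia.
  by congr _%:R; ring.
have [szg lcg] := reflect_poly_top (m + d)%:R (binom_poly R d).
have [szu lcu] := gram_top R le_dm.
rewrite size_binom_poly in szg lcg.
have low : (size (gram R m d - 'C(d + d, d)%:R *: g)%R <= d)%N.
  apply: size_sub_same_lead; rewrite ?szu //.
    by rewrite (leq_trans (size_scale_leq _ _)) ?szg.
  rewrite lead_coefE szu in lcu; rewrite lcu coefZ.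
  rewrite lead_coefE szg in lcg; rewrite lcg lead_coef_binom_poly /=.
  by rewrite mulrCA mulrA.
have le_dm1 : (d <= m.+1)%N by apply: leqW.
have [c def_p] := gram_basis le_dm1 low.
rewrite natrM -dot_g; apply/eqP; rewrite -subr_eq0 -(grid_dotC _ g).
have := grid_dot_gram_basis c le_dm1 le_dm; rewrite -def_p ltnn => <-.
rewrite /grid_dot mulr_sumr -sumrB; apply/eqP; apply: eq_bigr => i _.
by rewrite hornerD hornerN hornerZ; ring.
Qed.

Lemma grid_dot_gram_gt0 m d : (d <= m)%N ->
  0 < grid_dot m (gram R m d) (gram R m d).
Proof.
by move=> le_dm; rewrite grid_dot_gram // ltr0n muln_gt0 !bin_gt0; lia.
Qed.

(** Such a [p] is a combination of the Gram polynomials of degree below d, and is orthogonal to each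
    of them. Hence an eigenpolynomial of degree d is determined by its leading coefficient. *)
Lemma hahn_eigen_small m d p : (d <= m)%N -> (size p <= d)%N ->
  hahn_eigen m d p -> p = 0.
Proof.
move=> le_dm le_pd hp; have le_dm1 : (d <= m.+1)%N by apply: leqW.
have [c def_p] := gram_basis le_dm1 le_pd.
rewrite def_p; apply: big1 => j _.
have le_jm : (j <= m)%N by apply: leq_trans (ltnW (ltn_ord j)) le_dm.
have := grid_dot_gram_basis c le_dm1 le_jm; rewrite -def_p ltn_ord.
rewrite (@hahn_eigen_orthogonal _ d j) //; last first.
- by rewrite gtn_eqF.
- by move=> x; apply: hahn_op_gram.
move/esym/eqP; rewrite mulf_eq0 => /orP[/eqP->|]; first by rewrite scale0r.
by rewrite gt_eqF // grid_dot_gram_gt0.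
Qed.

(** The operator commutes with the reflection, so the difference of the two sides is an
    eigenpolynomial whose terms of degree d cancel: it is 0 by [hahn_eigen_small]. *)
Lemma gram_reflection m d x : (d <= m)%N ->
  (gram R m d).[m%:R - x] = (-1) ^+ d * (gram R m d).[x].
Proof.
move=> le_dm; pose p := reflect_poly m%:R (gram R m d) - (-1) ^+ d *: gram R m d.
have [szr lcr] := reflect_poly_top m%:R (gram R m d).
have sg := size_gram R le_dm; rewrite sg in szr lcr.
suff /(congr1 (fun q => q.[x])) : p = 0.
  by rewrite /p hornerD hornerN hornerZ horner_reflect_poly horner0 => /subr0_eq.
apply: (@hahn_eigen_small m d) => //.
  apply: size_sub_same_lead; rewrite ?szr //.
    by rewrite (leq_trans (size_scale_leq _ _)) ?sg.
  by rewrite coefZ; move: lcr; rewrite !lead_coefE szr sg.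
have hp y : p.[y] = (gram R m d).[m%:R - y] - (-1) ^+ d * (gram R m d).[y].
  by rewrite /p hornerD hornerN hornerZ horner_reflect_poly.
move=> y; rewrite {1}/hahn_op !hp.
transitivity (hahn_op m (horner (gram R m d)) (m%:R - y) -
  (-1) ^+ d * hahn_op m (horner (gram R m d)) y).
  rewrite /hahn_op.
  have -> : m%:R - y + 1 = m%:R - (y - 1) by ring.
  have -> : m%:R - y - 1 = m%:R - (y + 1) by ring.
  by rewrite -natr1; ring.
by rewrite !hahn_op_gram //; ring.
Qed.

End GramOrthogonality.

(** * Values beyond the ends of the grid, and a maximum principle *)

Section GramValues.
Variable R : realFieldType.
Implicit Types (x w : R) (k m d : nat).

Lemma binom_poly_opp k w : (binom_poly R k).[- w] =
  (-1) ^+ k * \prod_(i < k) ((w + i%:R) / i.+1%:R).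
Proof.
elim: k => [|k IHk]; first by rewrite binom_poly0 big_ord0 mulr1.
apply: (mulfI (factS_neq0 R k)); rewrite binom_polyS IHk big_ord_recr /= exprS.
have := factS_neq0 R k; move: (k.+1%:R) (\prod_(i < k) _) => a P nz.
by field.
Qed.

(** The signs of the coefficients cancel those of the binomial polynomials, so for w >= 0 all terms
    are nonnegative. At w = 1 every product is 1 and [sum_bin_multiset] gives the value. *)
Lemma gram_opp m d w : (gram R m d).[- w] =
  \sum_(k < d.+1) (gram_coef m d k)%:R * \prod_(i < k) ((w + i%:R) / i.+1%:R).
Proof.
rewrite /gram horner_sum; apply: eq_bigr => k _.
by rewrite hornerZ binom_poly_opp mulrACA -expr2 sqrr_sign mul1r.
Qed.

Lemma gram_le_left m d w : (d <= m)%N -> 0 <= w <= 1 ->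
  `|(gram R m d).[- w]| <= 'C(m.+1 + d, d)%:R.
Proof.
move=> le_dm /andP[w0 w1].
have F i : 0 <= (w + i%:R) / i.+1%:R <= 1.
  rewrite divr_ge0 ?addr_ge0 ?ler0n //= ler_pdivrMr ?ltr0Sn // mul1r.
  by rewrite -natr1 addrC lerD2l.
have P k : 0 <= \prod_(i < k) ((w + i%:R) / i.+1%:R) <= 1.
  by rewrite prodr_ge0 /= ?prodr_ile1 // => i _; case/andP: (F i).
rewrite gram_opp ger0_norm; last first.
  by apply: sumr_ge0 => k _; rewrite mulr_ge0 ?ler0n //; case/andP: (P k).
rewrite -(sum_bin_multiset le_dm) natr_sum; apply: ler_sum => k _.
by rewrite ler_piMr ?ler0n //; case/andP: (P k).
Qed.

Lemma gram_ge_half m d : (d <= m)%N ->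
  'C(m.+1 + d, d)%:R / (2 * d.+1%:R) <= (gram R m d).[- 2^-1].
Proof.
move=> le_dm; rewrite gram_opp -(sum_bin_multiset le_dm) natr_sum mulr_suml.
apply: ler_sum => k _; rewrite ler_wpM2l ?ler0n //.
have kd : (k <= d)%N by rewrite -ltnS.
have aux j : (2 * j.+1%:R)^-1 <= \prod_(i < j) ((2^-1 + i%:R) / i.+1%:R) :> R.
  case: j => [|j]; first by rewrite big_ord0 mulr1; lra.
  (* For a nonempty product the sharper bound 1 / (2 j) passes through the induction: the first
     factor is 1 / 2, and the others are at least i / (i + 1), which telescopes. *)
  have : (2 * j.+1%:R)^-1 <= \prod_(i < j.+1) ((2^-1 + i%:R) / i.+1%:R) :> R.
    elim: j => [|j IHj]; first by rewrite big_ord1 mulr1 divr1 addr0.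
    rewrite big_ord_recr /=.
    have le2 : j.+1%:R / j.+2%:R <= (2^-1 + j.+1%:R) / j.+2%:R :> R.
      by rewrite ler_pM2r ?invr_gt0 ?ltr0Sn // lerDr invr_ge0.
    have := ler_pM _ _ IHj le2; rewrite !invr_ge0 !divr_ge0 ?mulr_ge0 ?ler0n //.
    move=> /(_ isT isT); apply: le_trans.
    by rewrite !invfM mulrA divfK ?pnatr_eq0.
  apply: le_trans; rewrite lef_pV2 ?qualifE /= ?mulr_gt0 ?ltr0Sn //.
  by rewrite ler_pM2l ?ler_nat.
apply: le_trans (aux k); rewrite lef_pV2 ?qualifE /= ?mulr_gt0 ?ltr0Sn //.
by rewrite ler_pM2l ?ler_nat.
Qed.

Lemma gram_le_right m d x : (d <= m)%N -> m%:R <= x <= m.+1%:R ->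
  `|(gram R m d).[x]| <= 'C(m.+1 + d, d)%:R.
Proof.
move=> le_dm /andP[mx xm].
have := gram_reflection (- (x - m%:R)) le_dm; rewrite opprK addrC subrK => ->.
by rewrite normrMsign; apply: gram_le_left => //; rewrite -natr1 in xm; lra.
Qed.

Lemma gram_le_grid m d i : (d <= m)%N -> (i <= m)%N ->
  (gram R m d).[i%:R] ^+ 2 <= grid_dot m (gram R m d) (gram R m d).
Proof.
move=> le_dm le_im; rewrite /grid_dot (bigD1 (Ordinal (le_im : (i < m.+1)%N))) //=.
rewrite expr2 lerDl; apply: sumr_ge0 => k _.
by rewrite -expr2 sqr_ge0.
Qed.

(* At a maximum of [|f|] the left side of the difference equation is at most
   [2 (a + b) |f x|], [a] and [b] being its coefficients. *)
Lemma hahn_max_principle m d (f : R -> R) x : 0 <= x <= m%:R ->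
  hahn_op m f x = - (d * d.+1)%:R * f x -> 0 < `|f x| ->
  `|f (x + 1)| <= `|f x| -> `|f (x - 1)| <= `|f x| ->
  (d * d.+1)%:R <= 4 * x * (m%:R - x) + 2 * m%:R.
Proof.
move=> /andP[x0 xm] hf fx0 fl fr.
set a := (x + 1) * (m%:R - x); set b := x * (m.+1%:R - x).
have a0 : 0 <= a by apply: mulr_ge0; lra.
have b0 : 0 <= b by apply: mulr_ge0; rewrite -?natr1; lra.
have e : ((d * d.+1)%:R - (a + b)) * f x = - (a * f (x + 1) + b * f (x - 1)).
  by move: hf; rewrite /hahn_op -/a -/b => hf; lra.
have le1 : ((d * d.+1)%:R - (a + b)) * `|f x| <= (a + b) * `|f x|.
  apply: (@le_trans _ _ `|((d * d.+1)%:R - (a + b)) * f x|).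
    by rewrite normrM ler_wpM2r // ler_norm.
  rewrite e normrN; apply: le_trans (ler_normD _ _) _; rewrite mulrDl.
  by rewrite (normrM a) (normrM b) (ger0_norm a0) (ger0_norm b0) lerD // ler_wpM2l.
rewrite ler_pM2r // in le1.
have -> : 4 * x * (m%:R - x) + 2 * m%:R = 2 * (a + b) by rewrite /a /b -natr1; ring.
lra.
Qed.

End GramValues.

(** * Bernstein's inequality for cosine sums *)

Section CosinePolynomials.
Variable R : realType.
Implicit Types (x y t : R) (a : nat -> R) (f g : R -> R).

Definition cos_sum a n t : R := \sum_(k < n) a k * cos (k%:R * t).

(** Here n counts the frequencies 0, ..., n - 1, in accordance with [size] for polynomials. *)
Definition cos_poly n f := exists a, forall t, f t = cos_sum a n t.

Lemma cos_polyD n f g :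
  cos_poly n f -> cos_poly n g -> cos_poly n (fun t => f t + g t).
Proof.
move=> [a fa] [b gb]; exists (fun k => a k + b k) => t.
by rewrite fa gb -big_split; apply: eq_bigr => k _; rewrite mulrDl.
Qed.

Lemma cos_polyZ n c f : cos_poly n f -> cos_poly n (fun t => c * f t).
Proof.
move=> [a fa]; exists (fun k => c * a k) => t.
by rewrite fa mulr_sumr; apply: eq_bigr => k _; rewrite mulrA.
Qed.

Lemma eq_cos_poly n f g : f =1 g -> cos_poly n f -> cos_poly n g.
Proof. by move=> fg [a fa]; exists a => t; rewrite -fg. Qed.

Lemma cos_poly_sum n m (F : nat -> R -> R) : (forall k, (k < m)%N -> cos_poly n (F k)) ->
  cos_poly n (fun t => \sum_(k < m) F k t).
Proof.
elim: m => [|m IHm] hF.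
  exists (fun=> 0) => t; rewrite big_ord0 /cos_sum big1 // => k _.
  by rewrite mul0r.
have := cos_polyD (IHm (fun k km => hF k (leqW km))) (hF m (ltnSn m)).
by apply: eq_cos_poly => t; rewrite big_ord_recr.
Qed.

Lemma cos_poly_cos n k : (k < n)%N -> cos_poly n (fun t => cos (k%:R * t)).
Proof.
move=> kn; exists (fun j => (j == k)%:R) => t.
rewrite /cos_sum (bigD1 (Ordinal kn)) //= eqxx mul1r big1 ?addr0 // => j.
by rewrite -val_eqE /= => /negbTE ->; rewrite mul0r.
Qed.

Lemma cos_poly_widen n m f : (n <= m)%N -> cos_poly n f -> cos_poly m f.
Proof.
move=> nm [a fa]; have : cos_poly m (fun t => \sum_(k < n) (a k * cos (k%:R * t))).
  apply: (@cos_poly_sum _ _ (fun k t => a k * cos (k%:R * t))) => k kn.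
  by apply: cos_polyZ; apply: cos_poly_cos; apply: leq_trans nm.
by apply: eq_cos_poly => t; rewrite fa.
Qed.

Lemma cosM x y : cos x * cos y = 2^-1 * (cos (x + y) + cos (x - y)).
Proof. by rewrite cosD cosB; field. Qed.

Lemma cos_poly_mul_cos n f : cos_poly n f -> cos_poly n.+1 (fun t => cos t * f t).
Proof.
move=> [a fa].
have : cos_poly n.+1 (fun t => \sum_(k < n) a k * (cos t * cos (k%:R * t))).
  apply: (@cos_poly_sum _ _ (fun k t => a k * (cos t * cos (k%:R * t)))) => k kn.
  apply: cos_polyZ.
  (* The product has frequencies k + 1 and |k - 1|; the distance of naturals below is 1 at k = 0 and
     k - 1 otherwise. *)
  have : cos_poly n.+1
     (fun t => 2^-1 * (cos (k.+1%:R * t) + cos (`|k.-1 - (k == 0)|%N%:R * t))).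
    apply: cos_polyZ; apply: cos_polyD; apply: cos_poly_cos => //.
    by case: (k) kn => [|j] /=; lia.
  apply: eq_cos_poly => t; rewrite [RHS]mulrC cosM; congr (_ * (_ + _)).
    by rewrite -natr1 mulrDl mul1r.
  case: (k) => [|j] /=; first by rewrite mul0r sub0r cosN mul1r.
  by congr cos; rewrite -[j.+1%:R]natr1; ring.
apply: eq_cos_poly => t; rewrite fa mulr_sumr.
by apply: eq_bigr => k _; rewrite mulrCA.
Qed.

Lemma cos_poly_horner n (p : {poly R}) : (size p <= n)%N ->
  cos_poly n (fun t => p.[cos t]).
Proof.
move=> sp; have : cos_poly n (fun t => \sum_(i < n) p`_i * cos t ^+ i).
  apply: (@cos_poly_sum _ _ (fun i t => p`_i * cos t ^+ i)) => i lt_in.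
  apply: cos_polyZ; apply: (cos_poly_widen lt_in).
  elim: i {lt_in} => [|i IHi].
    have := @cos_poly_cos 1 0 isT; apply: eq_cos_poly => t.
    by rewrite mul0r cos0 expr0.
  by have := cos_poly_mul_cos IHi; apply: eq_cos_poly => t; rewrite exprS.
by apply: eq_cos_poly => t; rewrite (horner_coef_wide _ sp).
Qed.

Lemma sin_nat_pi n : sin (n%:R * pi) = 0 :> R.
Proof.
elim: n => [|n IHn]; first by rewrite mul0r sin0.
by rewrite -natr1 mulrDl mul1r sinDpi IHn oppr0.
Qed.

(** Multiplied by sin (b / 2), nonzero as 0 < b / 2 < pi, the sum telescopes over a whole number of
    periods. *)
Lemma sum_cos_zero n j : (0 < j < n)%N ->
  \sum_(r < n) cos (r%:R * (j%:R * (pi *+ 2) / n%:R)) = 0 :> R.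
Proof.
move=> /andP[j0 jn]; set b : R := j%:R * (pi *+ 2) / n%:R.
have n0 : (n%:R : R) != 0 by rewrite pnatr_eq0; lia.
have sb : sin (b / 2) != 0.
  rewrite gt_eqF // sin_gt0_pi //.
  have -> : b / 2 = pi * (j%:R / n%:R) by rewrite /b; field.
  rewrite mulr_gt0 ?pi_gt0 ?divr_gt0 ?ltr0n //=; last by lia.
  by rewrite -[ltRHS]mulr1 ltr_pM2l ?pi_gt0 // ltr_pdivrMr ?mul1r ?ltr_nat ?ltr0n; lia.
pose V r : R := sin (r%:R * b - b / 2).
apply: (mulfI sb); rewrite mulr0 mulr_sumr.
rewrite (eq_bigr (fun r : 'I_n => 2^-1 * (V r.+1 - V r))) => [|r _]; last first.
  rewrite /V -natr1 (_ : _ * b - b / 2 = r%:R * b + b / 2); last by field.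
  by rewrite sinD sinB; field.
rewrite -mulr_sumr -(big_mkord predT (fun r => V r.+1 - V r)) telescope_sumr //.
rewrite /V mul0r sub0r (_ : n%:R * b = 0 + pi *+ 2 *+ j); last first.
  by rewrite /b add0r -[in RHS]mulr_natl; field.
by rewrite addrAC (periodicn (@sinD2pi R)) add0r subrr mulr0.
Qed.

End CosinePolynomials.

(** * Discrete Fejér kernel and Riesz interpolation *)

Section Bernstein.
Variable R : realType.
Implicit Types (x y t : R) (a : nat -> R).

Definition node d r : R := r%:R * (pi *+ 2) / (d.*2)%:R.

(** The bounds on p and q exclude aliasing: a nonzero p - q is not a multiple of 2 d. *)
Lemma sum_cos_node d p q : (p < q + d.*2)%N -> (q < p + d.*2)%N ->
  \sum_(r < d.*2) cos ((p%:R - q%:R) * node d r) = (d.*2 * (p == q))%:R.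
Proof.
wlog le_pq : p q / (q <= p)%N => [hw hp hq|].
  have [/hw->//|/ltnW/hw] := leqP q p; rewrite eq_sym => <- //.
  by apply: eq_bigr => r _; rewrite -cosN -mulNr opprB.
move=> hp hq; have [->|neq_pq] := eqVneq p q.
  rewrite muln1; under eq_bigr => r _ do rewrite subrr mul0r cos0.
  by rewrite sumr_const card_ord.
rewrite muln0 mulr0n -[RHS](@sum_cos_zero R d.*2 (p - q)); last by lia.
apply: eq_bigr => r _; rewrite natrB // /node; congr cos; ring.
Qed.

(** Up to normalization, the Fejér kernel at the angle pi r / d, written as the squared modulus of
    an exponential sum so that its sign is visible. *)
Definition fejer_weight d r : R := (d.*2)%:R^-1 *
  ((\sum_(s < d) cos (s%:R * node d r)) ^+ 2 +
   (\sum_(s < d) sin (s%:R * node d r)) ^+ 2).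

Lemma fejer_weight_ge0 d r : 0 <= fejer_weight d r.
Proof. by rewrite mulr_ge0 ?invr_ge0 ?ler0n // addr_ge0 ?sqr_ge0. Qed.

Lemma fejer_weightE d r : fejer_weight d r =
  (d.*2)%:R^-1 * \sum_(s < d) \sum_(t < d) cos ((s%:R - t%:R) * node d r).
Proof.
congr (_ * _); rewrite !expr2 !mulr_suml -big_split /=.
apply: eq_bigr => s _; rewrite !mulr_sumr -big_split /=.
by apply: eq_bigr => t _; rewrite mulrBl cosB.
Qed.

Lemma sum_nat_shift_eq d k :
  (\sum_(s < d) \sum_(t < d) (s == t + k :> nat) = d - k)%N.
Proof.
rewrite exchange_big /=.
transitivity (\sum_(t < d) (t < d - k))%N.
  apply: eq_bigr => t _; rewrite ltn_subRL addnC.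
  case: ltnP => [lt|le].
    rewrite (bigD1 (Ordinal lt)) //= eqxx big1 // => s.
    by rewrite -val_eqE /= => /negbTE->.
  by rewrite big1 // => s _; rewrite ltn_eqF // (leq_trans (ltn_ord s)).
rewrite -(big_mkord predT (fun i => nat_of_bool (i < d - k)%N)).
rewrite (@big_cat_nat _ _ _ (d - k)%N) ?leq_subr //=.
rewrite [X in (_ + X)%N]big_nat [X in (_ + X)%N]big1; last first.
  by move=> i /andP[le _]; rewrite ltnNge le.
rewrite addn0 big_nat (eq_bigr (fun=> 1%N)) => [|i /= ->//].
by rewrite -big_nat sum_nat_const_nat muln1 subn0.
Qed.

(** By discrete orthogonality only the pairs (s, t) with s - t = k or t - s = k survive; there are d
    - k of each kind. *)
Lemma sum_fejer_weight_cos d k : (0 < d)%N -> (k <= d)%N ->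
  \sum_(r < d.*2) fejer_weight d r * cos (k%:R * node d r) = (d - k)%:R.
Proof.
move=> d0 kd; have nz : ((d.*2)%:R : R) != 0 by rewrite pnatr_eq0; lia.
under eq_bigr => r _ do rewrite fejer_weightE -mulrA mulr_suml.
rewrite -mulr_sumr exchange_big /=; apply: (canLR (mulKf nz)).
transitivity (\sum_(s < d) \sum_(t < d) (d.*2)%:R * (2^-1 *
    ((s + k == t :> nat)%N%:R + (s == t + k :> nat)%N%:R)) : R).
  apply: eq_bigr => s _; under eq_bigr => r _ do rewrite mulr_suml.
  rewrite exchange_big /=; apply: eq_bigr => t _.
  under eq_bigr => r _ do rewrite cosM -mulrDl -mulrBl addrAC -natrD -addrA -opprD -natrD.
  rewrite -mulr_sumr big_split /= !sum_cos_node ?natrM; [by ring| | | |];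
    move: (ltn_ord s) (ltn_ord t); lia.
under eq_bigr => s _ do rewrite -!mulr_sumr big_split /=.
rewrite -!mulr_sumr big_split /=; congr (_ * _).
rewrite exchange_big /=.
have e : \sum_(s < d) \sum_(t < d) ((s == t + k :> nat)%N%:R : R) = (d - k)%:R.
  by rewrite -sum_nat_shift_eq natr_sum; apply: eq_bigr => s _; rewrite natr_sum.
under eq_bigr => s _ do under eq_bigr => t _ do rewrite eq_sym.
by rewrite e; field.
Qed.

(** The angle d [node d r] is a multiple of pi, so its sine is 0. The sign left over turns the Fejér
    multiplier d - k into k. *)
Lemma cos_node_sub d k r : (0 < d)%N -> (k <= d)%N ->
  cos ((d - k)%:R * node d r) = cos (d%:R * node d r) * cos (k%:R * node d r).
Proof.
move=> d0 kd; rewrite natrB // mulrBl cosB.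
have -> : d%:R * node d r = r%:R * pi.
  have nz : (d%:R : R) != 0 by rewrite pnatr_eq0; lia.
  by rewrite /node -muln2 natrM -[pi *+ 2]mulr_natl; field.
by rewrite sin_nat_pi mul0r addr0.
Qed.

(* M. Riesz' interpolation formula for the operator [cos (k t) |-> k * cos (k t)],
   which has norm [d] on cosine sums of degree at most [d]. *)
Lemma bernstein_cos_sum a d G : (forall t, `|cos_sum a d.+1 t| <= G) ->
  forall t, `|cos_sum (fun k => k%:R * a k) d.+1 t| <= d%:R * G.
Proof.
move=> ha t; case: d ha => [|d'] ha.
  by rewrite /cos_sum big_ord1 !mul0r normr0.
set d := d'.+1; have d0 : (0 < d)%N by [].
(* The sum of |w r| is at most that of the Fejér weights, which is d by the case k = 0 of
   [sum_fejer_weight_cos]. *)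
pose w r := fejer_weight d r * cos (d%:R * node d r).
have -> : cos_sum (fun k => k%:R * a k) d.+1 t =
  \sum_(r < d.*2) w r * (2^-1 * (cos_sum a d.+1 (t + node d r) +
     cos_sum a d.+1 (t - node d r))).
  transitivity (\sum_(k < d.+1) \sum_(r < d.*2)
      w r * (a k * (cos (k%:R * t) * cos (k%:R * node d r)))).
    apply: eq_bigr => k _; have kd : (k <= d)%N by rewrite -ltnS.
    have := sum_fejer_weight_cos d0 (leq_subr k d); rewrite subKn // => e.
    rewrite -[X in X * a k]e !mulr_suml; apply: eq_bigr => r _.
    by rewrite cos_node_sub // /w; ring.
  rewrite exchange_big /=; apply: eq_bigr => r _; rewrite -mulr_sumr.
  congr (_ * _); rewrite /cos_sum -big_split /= mulr_sumr; apply: eq_bigr => k _.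
  by rewrite cosM !mulrDr mulrN; ring.
apply: le_trans (ler_norm_sum _ _ _) _.
have := sum_fejer_weight_cos d0 (leq0n d); rewrite subn0 => <-.
rewrite mulr_suml; apply: ler_sum => r _.
rewrite mul0r cos0 mulr1 /w (normrM (_ * cos _)) (normrM (fejer_weight d r)).
rewrite (normrM 2^-1) (ger0_norm (fejer_weight_ge0 d r)).
rewrite -mulrA ler_wpM2l ?fejer_weight_ge0 //.
apply: (@le_trans _ _ (1 * G)); last by rewrite mul1r.
apply: ler_pM => //.
  by rewrite ler_norml cos_geN1 cos_le1.
rewrite normfV (ger0_norm (ler0n _ 2)) ler_pdivrMl ?ltr0n //.
apply: le_trans (ler_normD _ _) _.
by rewrite mulr_natl mulr2n lerD.
Qed.

End Bernstein.

(** * Cosine sums near a maximum *)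

Section NearMaximum.
Variable R : realType.
Implicit Types (x y t : R) (a : nat -> R) (f g : R -> R).

Lemma MVT_everywhere f df x y : x <= y -> (forall t, is_derive t 1 f (df t)) ->
  exists2 z, x <= z <= y & f y - f x = df z * (y - x).
Proof.
move=> xy hf.
have cf : {within `[x, y], continuous f}%classic.
  by apply: derivable_within_continuous => t _; apply: ex_derive.
have [z] := @MVT_segment R f df x y xy (fun t _ => hf t) cf.
by rewrite in_itv /= => hz e; exists z.
Qed.

Lemma second_order_min f df ddf t0 : (forall t, is_derive t 1 f (df t)) ->
  (forall t, is_derive t 1 df (ddf t)) -> (forall t, 0 <= ddf t) ->
  df t0 = 0 -> forall t, t0 <= t -> f t0 <= f t.
Proof.
move=> hf hdf ddf0 df0 t t0t.
have [z /andP[t0z _] e] := MVT_everywhere t0t hf.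
have [u _ e'] := MVT_everywhere t0z hdf.
rewrite -subr_ge0 e mulr_ge0 ?subr_ge0 //.
move: e'; rewrite df0 subr0 => ->.
by rewrite mulr_ge0 ?subr_ge0.
Qed.

Definition sin_sum a n t : R := \sum_(k < n) a k * sin (k%:R * t).

Lemma is_derive_cos_sum a n t :
  is_derive t 1 (cos_sum a n) (- sin_sum (fun k => k%:R * a k) n t).
Proof.
rewrite /cos_sum /sin_sum -sumrN.
have -> : (fun t0 => \sum_(k < n) a k * cos (k%:R * t0)) =
   \sum_(k < n) (fun t0 => a k * cos (k%:R * t0)).
  by apply/funext => u; rewrite fct_sumE.
apply: is_derive_sum => k.
by apply: is_derive_eq; rewrite /GRing.scale /=; ring.
Qed.

Lemma is_derive_sin_sum a n t :
  is_derive t 1 (sin_sum a n) (cos_sum (fun k => k%:R * a k) n t).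
Proof.
rewrite /cos_sum /sin_sum.
have -> : (fun t0 => \sum_(k < n) a k * sin (k%:R * t0)) =
   \sum_(k < n) (fun t0 => a k * sin (k%:R * t0)).
  by apply/funext => u; rewrite fct_sumE.
apply: is_derive_sum => k.
by apply: is_derive_eq; rewrite /GRing.scale /=; ring.
Qed.

Lemma cos_sumN a n t : cos_sum a n (- t) = cos_sum a n t.
Proof. by apply: eq_bigr => k _; rewrite mulrN cosN. Qed.

(** Applying cos (k t) |-> k cos (k t) twice gives minus the second derivative, so Bernstein's
    inequality bounds the latter by d^2 G. Adding the parabola makes the sum convex, with a critical
    point at the maximum. *)
Lemma cos_sum_near_max a d (G t0 : R) : (forall t, `|cos_sum a d.+1 t| <= G) ->
cos_sum a d.+1 t0 = G ->
forall t, G - d%:R ^+ 2 * G * (t - t0) ^+ 2 / 2 <= cos_sum a d.+1 t.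
Proof.
move=> ha.
have right t1 : cos_sum a d.+1 t1 = G -> forall t, t1 <= t ->
  G - d%:R ^+ 2 * G * (t - t1) ^+ 2 / 2 <= cos_sum a d.+1 t.
  move=> max_t1 t t1t; set c := d%:R ^+ 2 * G.
  set ka := fun k => k%:R * a k; set kka := fun k => k%:R * ka k.
  pose F t := cos_sum a d.+1 t + c / 2 * (t - t1) ^+ 2.
  pose dF t := - sin_sum ka d.+1 t + c * (t - t1).
  pose ddF t := - cos_sum kka d.+1 t + c.
  have hF (u : R) : is_derive u 1 F (dF u).
    have du := is_derive_cos_sum a d.+1 u.
    by apply: is_derive_eq; rewrite /dF /ka /GRing.scale /=; field.
  have hdF (u : R) : is_derive u 1 dF (ddF u).
    have du := is_derive_sin_sum ka d.+1 u.
    by apply: is_derive_eq; rewrite /ddF /kka /GRing.scale /=; field.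
  have ddF0 u : 0 <= ddF u.
    rewrite /ddF addrC subr_ge0.
    have := bernstein_cos_sum (bernstein_cos_sum ha) u.
    by rewrite mulrA -expr2 => h; apply: le_trans (ler_norm _) h.
  have dF0 : dF t1 = 0.
    have lt1 : t1 \in `](t1 - 1), (t1 + 1)[ by rewrite in_itv /=; lra.
    have le1 : t1 - 1 <= t1 + 1 by lra.
  have der (u : R) : u \in `](t1 - 1), (t1 + 1)[ -> derivable (cos_sum a d.+1) u 1.
    by move=> _; have [] := is_derive_cos_sum a d.+1 u.
  have le_max (u : R) : u \in `](t1 - 1), (t1 + 1)[ ->
      cos_sum a d.+1 u <= cos_sum a d.+1 t1.
    by move=> _; rewrite max_t1; apply: le_trans (ler_norm _) (ha u).
  have [_ e0] := derive1_at_max le1 der lt1 le_max.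
  have := is_derive_cos_sum a d.+1 t1 => -[_ e1].
    by rewrite /dF subrr mulr0 addr0 -e1 e0.
  have := second_order_min hF hdF ddF0 dF0 t1t.
  by rewrite /F max_t1 subrr expr0n /= mulr0 addr0 lerBlDr; congr (_ <= _); field.
move=> max_t0 t; have [t0t|/ltW tt0] := leP t0 t; first exact: right.
(* The left side reduces to the right side because cosine sums are even. *)
rewrite -cos_sumN; have -> : (t - t0) ^+ 2 = (- t - - t0) ^+ 2 by ring.
by apply: right; rewrite ?cos_sumN ?lerN2.
Qed.

End NearMaximum.

(** * Gram polynomials between the grid points *)

Section GramBound.
Variable R : realType.
Implicit Types (x y t : R) (p : {poly R}).

Lemma cos_le0pi x y : 0 <= x -> x <= y -> y <= pi -> cos y <= cos x.
Proof.
move=> x0; rewrite le_eqVlt => /predU1P[->//|xy] ypi; apply: ltW.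
by rewrite ltr_cos // in_itv /=; apply/andP; split; lra.
Qed.

(** The mean value theorem for cos applies at some z between the two angles; cos z lies between v
    and u, which forces sin z >= s. *)
Lemma acos_lipschitz (s u v : R) : 0 < s -> -1 <= u <= 1 -> -1 <= v <= 1 ->
  s ^+ 2 <= 1 - u ^+ 2 -> s ^+ 2 <= 1 - v ^+ 2 ->
  s * `|acos u - acos v| <= `|u - v|.
Proof.
move=> s0; wlog le_uv : u v / acos u <= acos v => [hw hu hv su sv|].
  have [h|/ltW h] := leP (acos u) (acos v); first exact: hw.
  by rewrite distrC [leRHS]distrC; apply: hw.
move=> hu hv su sv; have [/andP[au0 aupi] cu] := acos_def hu.
have [/andP[av0 avpi] cv] := acos_def hv.
have [z /andP[uz zv]] := MVT_everywhere le_uv (@is_derive_cos R).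
rewrite cu cv -normrN opprB [`|u - v|]distrC => ->.
rewrite normrM normrN ler_wpM2r //.
have sz : 0 <= sin z by apply: sin_ge0_pi; lra.
rewrite ger0_norm // -(@ler_pXn2r _ 2) // ?nnegrE ?(ltW s0) // sin2cos2.
have c1 : cos z <= u by rewrite -cu; apply: cos_le0pi => //; lra.
have c2 : v <= cos z by rewrite -cv; apply: cos_le0pi => //; lra.
have [cz|/ltW cz] := leP 0 (cos z); nra.
Qed.

(** The substitution x = c + H cos t turns p into a cosine sum of degree at most d. As [kappa / H]
    bounds sin t from below at both points, d times the difference of the angles is at most 1, and
    the parabola of [cos_sum_near_max] loses at most G / 2. *)
Lemma poly_near_max p d (c H G x0 y kappa : R) : (size p <= d.+1)%N -> 0 < H ->
  (forall x, c - H <= x <= c + H -> `|p.[x]| <= G) ->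
  `|p.[x0]| = G -> c - H <= x0 <= c + H -> c - H <= y <= c + H ->
  0 < kappa ->
  kappa ^+ 2 <= H ^+ 2 - (x0 - c) ^+ 2 -> kappa ^+ 2 <= H ^+ 2 - (y - c) ^+ 2 ->
  d%:R * `|x0 - y| <= kappa -> G / 2 <= `|p.[y]|.
Proof.
move=> sp H0; wlog px0 : p sp / 0 <= p.[x0] => [hw|] hG max_x0 hx0 hy k0 kx ky dk.
  have [h|/ltW h] := leP 0 p.[x0]; first exact: (hw p).
  have := hw (- p); rewrite size_polyN !hornerN !normrN oppr_ge0; apply=> //.
  by move=> x hx; rewrite hornerN normrN; apply: hG.
have G0 : 0 <= G by rewrite -max_x0.
rewrite ger0_norm // in max_x0.
have nzH : H != 0 by rewrite gt_eqF.
have itv x : c - H <= x <= c + H -> -1 <= (x - c) / H <= 1.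
  move=> /andP[h1 h2]; rewrite ler_pdivlMr // ler_pdivrMr //.
  by apply/andP; split; lra.
have cosx x : c - H <= x <= c + H -> c + H * cos (acos ((x - c) / H)) = x.
  by move=> /itv h; have [_ ->] := acos_def h; field.
pose q := p \Po (H *: 'X + c%:P).
have hq t : q.[t] = p.[c + H * t] by rewrite /q horner_comp !hornerE addrC.
have sq : (size q <= d.+1)%N.
  apply: leq_trans (size_comp_poly_leq _ _) _.
  have -> : size (H *: 'X + c%:P) = 2%N.
    by rewrite size_polyDl size_scale ?size_polyX // size_polyC; case: (_ == _).
  by rewrite muln1 ltnS -subn1 leq_subLR add1n.
have [a ha] := cos_poly_horner sq.
have bnd t : `|cos_sum a d.+1 t| <= G.
  rewrite -ha hq; apply: hG.
  by have := cos_geN1 t; have := cos_le1 t => c1 c2; apply/andP; split; nra.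
set t0 := acos ((x0 - c) / H); set t1 := acos ((y - c) / H).
have max_t0 : cos_sum a d.+1 t0 = G by rewrite -ha hq cosx.
have := cos_sum_near_max bnd max_t0 t1; rewrite -ha hq cosx //.
have lip : d%:R * `|t1 - t0| <= 1.
  have [kH s0] : kappa / H * H = kappa /\ 0 < kappa / H by rewrite divfK ?divr_gt0.
  have sub x : kappa ^+ 2 <= H ^+ 2 - (x - c) ^+ 2 ->
      (kappa / H) ^+ 2 <= 1 - ((x - c) / H) ^+ 2.
    move=> h; rewrite !expr_div_n -(@divff _ (H ^+ 2)) ?expf_neq0 // -mulrBl.
    by rewrite ler_pM2r ?invr_gt0 ?exprn_gt0.
  have := acos_lipschitz s0 (itv _ hy) (itv _ hx0) (sub _ ky) (sub _ kx).
  rewrite -/t0 -/t1 -mulrBl normrM normfV (gtr0_norm H0).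
  rewrite (_ : y - c - (x0 - c) = y - x0); last by ring.
  rewrite distrC [`|y - _|]distrC => h; rewrite distrC.
  rewrite -(ler_pM2l k0) mulr1; apply: le_trans dk.
  rewrite -(ler_pM2r H0) in h; rewrite divfK // in h.
  have d0 : 0 <= d%:R :> R by [].
  rewrite mulrCA ler_wpM2l //; apply: le_trans h.
  by rewrite mulrAC kH distrC.
have : (d%:R * `|t1 - t0|) ^+ 2 <= 1 by rewrite expr_le1 ?mulr_ge0 ?ler0n.
rewrite exprMn real_normK ?num_real // => h1 h2.
apply: le_trans (ler_norm _); nra.
Qed.

Lemma gram_bound m d (A : R) x : (d <= m)%N ->
  (forall i, (i <= m)%N -> `|(gram R m d).[i%:R]| <= A) ->
  0 <= x <= m%:R ->
  `|(gram R m d).[x]| <= Num.max (2 * A) 'C(m.+1 + d, d)%:R.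
Proof.
move=> le_dm hA x_in.
set p := gram R m d; set C : R := 'C(m.+1 + d, d)%:R.
have cont : {within `[-1, m.+1%:R], continuous (fun x => `|p.[x]|)}%classic.
  apply: continuous_subspaceT => u; apply: (@continuous_comp _ _ _ (horner p) Num.norm).
    exact: continuous_horner.
  exact: norm_continuous.
have le_ends : -1 <= m.+1%:R :> R by rewrite (le_trans _ (ler0n _ _)) ?lerN10.
(* The range extends one unit beyond both ends, so that it contains z - 1 and z + 1 whenever 0 <= z
   <= m. *)
have [z] := EVT_max le_ends cont; rewrite in_itv /= => /andP[z1 zm] max_z.
have mS : m.+1%:R = m%:R + 1 :> R by rewrite natr1.
have hG u : -1 <= u <= m.+1%:R -> `|p.[u]| <= `|p.[z]|.
  by move=> hu; apply: max_z; rewrite in_itv.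
apply: (@le_trans _ _ `|p.[z]|); first by apply: hG; lra.
rewrite le_max; have [z0|z0] := leP z 0.
  by apply/orP; right; rewrite -[z]opprK; apply: gram_le_left => //; lra.
have [mz|zm'] := leP m%:R z.
  by apply/orP; right; apply: gram_le_right => //; lra.
apply/orP; left; have A0 : 0 <= A by apply: le_trans (hA 0%N isT).
have [pz0|] := eqVneq p.[z] 0; first by rewrite pz0 normr0 mulr_ge0.
rewrite -normr_gt0 => pz0.
have hz : 0 <= z <= m%:R by rewrite !ltW.
have band : (d * d.+1)%:R <= 4 * z * (m%:R - z) + 2 * m%:R.
  have := @hahn_max_principle _ m d (horner p) z hz (hahn_op_gram z le_dm) pz0.
  by apply; apply: hG; lra.
have [i le_im zi] : exists2 i, (i <= m)%N & -1 <= 2 * (z - i%:R) <= 1.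
  have /andP[] := truncn_itv (ltW z0); set j := Num.truncn z; rewrite -natr1 => jz zj.
  have lt_jm : (j < m)%N by rewrite -(ltr_nat R); apply: le_lt_trans zm'.
  have [h|h] := leP (2 * (z - j%:R)) 1; first by exists j; [exact: ltnW | lra].
  by exists j.+1 => //; rewrite -natr1; lra.
have i0 : 0 <= i%:R :> R by [].
have im : i%:R <= m%:R :> R by rewrite ler_nat.
have d0 : 0 <= d%:R :> R by [].
have m0 : 0 <= m%:R :> R by [].
rewrite natrM -[d.+1%:R]natr1 in band.
have half : `|p.[z]| / 2 <= `|p.[i%:R]|.
  (* With kappa = d / 2 + 1 / 4, kappa^2 = d (d + 1) / 4 + 1 / 16 is controlled by [band], and d |z
     - i| <= d / 2 <= kappa. On [-1, m + 1], H^2 - (z - m / 2)^2 = z (m - z) + m + 1; moving from z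
     to i costs at most m / 2 of it. *)
  apply: (@poly_near_max p d (m%:R / 2) (m%:R / 2 + 1) _ z _ (d%:R / 2 + 4^-1)) => //.
  - by rewrite size_gram.
  - by move=> u hu; apply: hG; lra.
  - lra.
  - lra.
  - lra.
  - nra.
  - have : `|z - i%:R| <= 2^-1 by rewrite ler_norml; lra.
    by move=> h; have := ler_wpM2l d0 h; lra.
by have := hA i le_im; lra.
Qed.

End GramBound.

(** * Growth factor in factorials, and polynomial bounds on {0, ..., m} *)

Lemma bin_sq_fact m d : (d <= m)%N ->
  ('C(m.+1 + d, d) ^ 2 * (m.+1)`! ^ 2 =
   (d + d).+1 * ((m.+1 + d)`! * (m - d)`!) *
     ('C(d + d, d) * 'C((m + d).+1, (d + d).+1)))%N.
Proof.
move=> le_dm.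
have e1 : ('C(m.+1 + d, d) * (d`! * (m.+1)`!) = (m.+1 + d)`!)%N.
  by rewrite -(@bin_fact (m.+1 + d) d) ?leq_addl // addnK.
have e2 : ('C(d + d, d) * (d`! * d`!) = (d + d)`!)%N.
  by rewrite -(@bin_fact (d + d) d) ?leq_addl // addnK.
have e3 : ('C((m + d).+1, (d + d).+1) * ((d + d).+1 * (d + d)`! * (m - d)`!) =
    (m.+1 + d)`!)%N.
  rewrite -factS addSn -(@bin_fact (m + d).+1 (d + d).+1); last by lia.
  by congr (_ * (_ * _`!))%N; lia.
have p0 : (0 < d`! * d`!)%N by rewrite muln_gt0 !fact_gt0.
apply/eqP; rewrite -(eqn_pmul2r p0); apply/eqP.
transitivity (('C(m.+1 + d, d) * (d`! * (m.+1)`!)) ^ 2)%N; first by ring.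
rewrite e1 -mulnn -[X in (X * _ = _)%N]e3 -e2; ring.
Qed.

Section Ratio.
Variable R : realType.
Implicit Types (x : R) (q : {poly R}).

(** The square of u_d(-1) divided by h_d is 2 d + 1 times this ratio, whose logarithm Stirling's
    formula evaluates. *)
Definition fact_ratio m d : R :=
  ((m.+1 + d)`! * (m - d)`!)%:R / ((m.+1)`! ^ 2)%:R.

Lemma fact_ratio_gt0 m d : 0 < fact_ratio m d.
Proof. by rewrite divr_gt0 ?ltr0n ?muln_gt0 ?fact_gt0. Qed.

(** A step from d to d + 1 multiplies by (m + d + 2) / (m - d) >= 1. Thus the top degree controls
    all the lower ones. *)
Lemma fact_ratio_mono m j d : (j <= d)%N -> (d <= m)%N ->
  fact_ratio m j <= fact_ratio m d.
Proof.
move=> le_jd le_dm; rewrite ler_pM2r ?invr_gt0 ?ltr0n ?expn_gt0 ?fact_gt0 //.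
rewrite ler_nat; elim: d le_jd le_dm => [|d IHd] le_jd le_dm.
  by move: le_jd; rewrite leqn0 => /eqP->.
move: le_jd; rewrite leq_eqVlt => /predU1P[->//|le_jd].
apply: leq_trans (IHd le_jd (ltnW le_dm)) _.
rewrite -[(m - d)%N]prednK ?subn_gt0 // -subnS addnS !factS mulnCA mulnA.
by rewrite -[leqRHS]mulnA -mulnA leq_mul2r; apply/orP; right; lia.
Qed.

Lemma fact_ratio0 m : fact_ratio m 0 = m.+1%:R^-1.
Proof.
have nz : (m`!%:R : R) != 0 by rewrite pnatr_eq0 -lt0n fact_gt0.
have nz1 : (m.+1%:R : R) != 0 by rewrite pnatr_eq0.
rewrite /fact_ratio addn0 subn0 -mulnn factS !natrM.
move: (m`!%:R) (m.+1%:R) nz nz1 => a b nz nz1.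
by field; rewrite nz nz1.
Qed.

Definition gram_norm m d : R := Num.sqrt (grid_dot m (gram R m d) (gram R m d)).

Lemma gram_norm_gt0 m d : (d <= m)%N -> 0 < gram_norm m d.
Proof. by move=> le_dm; rewrite sqrtr_gt0 grid_dot_gram_gt0. Qed.

Lemma gram_le_norm m d i : (d <= m)%N -> (i <= m)%N ->
  `|(gram R m d).[i%:R]| <= gram_norm m d.
Proof.
move=> le_dm le_im; rewrite -sqrtr_sqr ler_wsqrtr //.
exact: gram_le_grid.
Qed.

Lemma bin_div_gram_norm m d : (d <= m)%N ->
  'C(m.+1 + d, d)%:R / gram_norm m d =
    Num.sqrt ((d + d).+1%:R * fact_ratio m d).
Proof.
move=> le_dm; have n0 := gram_norm_gt0 le_dm.
have d0 := grid_dot_gram_gt0 R le_dm.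
have <- : Num.sqrt (('C(m.+1 + d, d)%:R / gram_norm m d) ^+ 2) =
    'C(m.+1 + d, d)%:R / gram_norm m d.
  by rewrite sqrtr_sqr ger0_norm // divr_ge0 // ltW.
congr Num.sqrt.
rewrite expr_div_n sqr_sqrtr ?ltW // /fact_ratio mulrA.
have nf : ((m.+1)`! ^ 2)%:R != 0 :> R by rewrite pnatr_eq0 -lt0n expn_gt0 fact_gt0.
apply/eqP; rewrite eqr_div // ?(gt_eqF d0) //.
by rewrite grid_dot_gram // -natrX -!natrM bin_sq_fact.
Qed.

(** In the Gram expansion of q, the coefficient of u_j is at most A (m + 1) / s, with s the norm of
    u_j, and |u_j(x)| is at most 3 S s. There are d + 1 <= m + 1 terms. *)
Lemma poly_grid_bound m d q (A x : R) : (d <= m)%N -> (size q <= d.+1)%N ->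
  (forall i, (i <= m)%N -> `|q.[i%:R]| <= A) -> 0 <= x <= m%:R ->
  `|q.[x]| <= A * (3 * m.+1%:R ^+ 2 * Num.sqrt (2 * m.+1%:R * fact_ratio m d)).
Proof.
move=> le_dm sq hA hx; have A0 : 0 <= A by apply: le_trans (hA 0%N isT).
have le_dm1 : (d.+1 <= m.+1)%N by [].
have [c def_q] := gram_basis le_dm1 sq.
set S := Num.sqrt _.
(* Needed for the alternative 2 s of the maximum in [gram_bound], which must also be below 3 S s. *)
have S1 : 1 <= S.
  rewrite -[leLHS]sqrtr1 ler_wsqrtr //.
  have r0 := fact_ratio_mono (leq0n d) le_dm.
  have N0 : 0 < m.+1%:R :> R by [].
  have : 2 * m.+1%:R * fact_ratio m 0 <= 2 * m.+1%:R * fact_ratio m d.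
    by rewrite ler_pM2l // mulr_gt0.
  by apply: le_trans; rewrite fact_ratio0 mulfK ?pnatr_eq0 // ler1n.
have bound j : (j <= d)%N -> `|c j * (gram R m j).[x]| <= A * m.+1%:R * (3 * S).
  move=> le_jd; have le_jm := leq_trans le_jd le_dm.
  have s0 := gram_norm_gt0 le_jm; set s := gram_norm m j in s0.
  have h0 := grid_dot_gram_gt0 R le_jm.
  have cj : `|c j| <= A * m.+1%:R / s.
    have := grid_dot_gram_basis c le_dm1 le_jm; rewrite ltnS le_jd -def_q.
    have ss : grid_dot m (gram R m j) (gram R m j) = s ^+ 2.
      by rewrite sqr_sqrtr // ltW.
    rewrite ss => /(congr1 Num.norm); rewrite normrM (gtr0_norm (exprn_gt0 2 s0)).
    move=> e; rewrite ler_pdivlMr // -(ler_pM2r s0) -[leLHS]mulrA -expr2 -e.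
    apply: le_trans (ler_norm_sum _ _ _) _.
    apply: (@le_trans _ _ (\sum_(i < m.+1) A * s)).
      apply: ler_sum => i _; have le_im : (i <= m)%N by rewrite -ltnS.
      by rewrite normrM; apply: ler_pM => //; [apply: hA | apply: gram_le_norm].
    rewrite sumr_const card_ord -mulr_natr le_eqVlt; apply/orP; left.
    by apply/eqP; ring.
  rewrite normrM.
  have uj := gram_bound le_jm (fun i => gram_le_norm le_jm) hx.
  apply: le_trans (ler_pM _ _ cj uj) _ => //.
  rewrite -!mulrA ler_wpM2l // ler_wpM2l // mulrC ler_pdivrMr //.
  have Cs : 'C(m.+1 + j, j)%:R <= S * s.
    rewrite -ler_pdivrMr // bin_div_gram_norm // ler_wsqrtr //.
    apply: ler_pM => //; first by rewrite ltW // fact_ratio_gt0.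
      by rewrite -natrM ler_nat; lia.
    exact: fact_ratio_mono.
  have sS : s <= S * s by rewrite ler_peMl // ltW.
  rewrite ge_max; apply/andP; split; rewrite -/s; last by lra.
  lra.
rewrite def_q horner_sum; apply: le_trans (ler_norm_sum _ _ _) _.
apply: (@le_trans _ _ (\sum_(j < d.+1) A * m.+1%:R * (3 * S))).
  by apply: ler_sum => j _; rewrite hornerZ; apply: bound; rewrite -ltnS.
rewrite sumr_const card_ord -(mulr_natr _ d.+1).
have dm : d.+1%:R <= m.+1%:R :> R by rewrite ler_nat.
apply: (@le_trans _ _ (A * m.+1%:R * (3 * S) * m.+1%:R)).
  by rewrite ler_wpM2l // !mulr_ge0 // sqrtr_ge0.
by rewrite le_eqVlt; apply/orP; left; apply/eqP; ring.
Qed.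

(** The factor x kills the large value u(-1) at the grid point 0. The factor 4 (m + 1)^2 collects 1
    / 2 from x, 2 (d + 1) from [gram_ge_half] and m + 1 from A. *)
Lemma poly_grid_example m d : (d <= m)%N -> exists q A,
  [/\ (size q <= d.+2)%N, 0 < A, (forall i, (i <= m.+1)%N -> `|q.[i%:R]| <= A) &
      A * (Num.sqrt (fact_ratio m d) / (4 * m.+1%:R ^+ 2)) <= `|q.[2^-1]| ].
Proof.
move=> le_dm; exists ('X * (gram R m d \Po ('X - 1%:P))), (m.+1%:R * gram_norm m d).
have hq x : ('X * (gram R m d \Po ('X - 1%:P))).[x] = x * (gram R m d).[x - 1].
  by rewrite hornerM horner_comp hornerXsubC hornerX.
have s0 := gram_norm_gt0 le_dm.
split.
- apply: leq_trans (size_polyMleq _ _) _; rewrite size_polyX /=.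
  by rewrite size_comp_poly2 ?size_XsubC // size_gram.
- by rewrite mulr_gt0.
- move=> [|i] le_im; first by rewrite hq mul0r normr0 ltW // mulr_gt0.
  rewrite hq -[i.+1%:R]natr1 addrK normrM ler_pM //.
    by rewrite ger0_norm ?addr_ge0 // natr1 ler_nat.
  exact: gram_le_norm.
rewrite hq (_ : 2^-1 - 1 = - 2^-1); last by lra.
apply: (@le_trans _ _ (2^-1 * (gram R m d).[- 2^-1])); last first.
  by rewrite normrM ger0_norm // ler_wpM2l // ler_norm.
have := gram_ge_half R le_dm; rewrite -(@ler_pM2l _ 2^-1) //; apply: le_trans.
have Cs : Num.sqrt (fact_ratio m d) * gram_norm m d <= 'C(m.+1 + d, d)%:R.
  rewrite -ler_pdivlMr // bin_div_gram_norm // ler_wsqrtr //.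
  by rewrite ler_peMl ?ler1n // ltW // fact_ratio_gt0.
apply: (@le_trans _ _ ('C(m.+1 + d, d)%:R / (4 * m.+1%:R))).
  have i0 : 0 <= (4 * m.+1%:R : R)^-1 by rewrite invr_ge0 mulr_ge0.
  apply: le_trans (ler_wpM2r i0 Cs).
  have nz : m.+1%:R != 0 :> R by rewrite pnatr_eq0.
  move: nz; move: (m.+1%:R) (Num.sqrt _) (gram_norm m d) => N r s nz.
  by rewrite le_eqVlt; apply/orP; left; apply/eqP; field.
rewrite mulrCA ler_wpM2l // -invfM mulrA (_ : 2 * 2 = 4); last by ring.
by rewrite lef_pV2 ?qualifE /= ?mulr_gt0 // ler_pM2l // ler_nat.
Qed.

End Ratio.

(** * Asymptotics *)

Section Stirling.
Variable R : realType.
Implicit Types (x : R).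

Lemma lnS_sub_bounds n : (0 < n)%N ->
  1 <= n.+1%:R * (ln n.+1%:R - ln n%:R) :> R /\
  n%:R * (ln n.+1%:R - ln n%:R) <= 1 :> R.
Proof.
move=> n0; have p0 : 0 < n%:R :> R by rewrite ltr0n.
have p1 : 0 < n.+1%:R :> R by rewrite ltr0n.
have eS : n.+1%:R = n%:R + 1 :> R by rewrite natr1.
rewrite -ln_div ?posrE //; split.
  have h := @le_ln1Dx R (- n.+1%:R^-1).
  have e : n.+1%:R / n%:R = (1 + - n.+1%:R^-1)^-1 :> R.
    rewrite eS; field; rewrite ?gt_eqF //; lra.
  rewrite e lnV; last first.
    by rewrite posrE -invr_gt0 -e divr_gt0.
  have : ln (1 - n.+1%:R^-1) <= - n.+1%:R^-1 :> R.
    by apply: h; rewrite ltrN2 invf_lt1 // ltr1n.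
  by move=> h'; rewrite -ler_pdivrMl // mulr1 lerNr.
have -> : n.+1%:R / n%:R = 1 + n%:R^-1 :> R.
  by rewrite eS; field; rewrite gt_eqF.
rewrite -ler_pdivlMl // mulr1; apply: le_ln1Dx.
by apply: lt_trans (_ : 0 < _); [lra | rewrite invr_gt0].
Qed.

(** Together with [ln_fact_le], a crude Stirling formula: its error, of order ln n, disappears after
    division by n. *)
Lemma ln_fact_ge n : n%:R * ln n%:R - n%:R <= ln (n`!%:R) :> R.
Proof.
elim: n => [|n IHn]; first by rewrite mul0r subrr ln1.
rewrite factS natrM lnM ?posrE ?ltr0n ?fact_gt0 //.
have eS : n.+1%:R = n%:R + 1 :> R by rewrite natr1.
case: n IHn eS => [|n] IHn eS; first by rewrite fact0 !ln1 mulr0; lra.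
have [_ h] := lnS_sub_bounds (ltn0Sn n).
rewrite [X in X * _ - _]eS [X in _ - X <= _]eS; lra.
Qed.

Lemma ln_fact_le n : (0 < n)%N ->
  ln (n`!%:R) <= n.+1%:R * ln n%:R - n%:R + 1 :> R.
Proof.
case: n => // n _; elim: n => [|n IHn]; first by rewrite ln1 mulr0; lra.
rewrite factS natrM lnM ?posrE ?ltr0n ?fact_gt0 //.
have [h _] := lnS_sub_bounds (ltn0Sn n).
have e2 : n.+2%:R = n.+1%:R + 1 :> R by rewrite natr1.
have e3 : n.+3%:R = n.+2%:R + 1 :> R by rewrite natr1.
rewrite [X in _ <= X * _ - _ + _]e3 [X in _ <= _ - X + _]e2; lra.
Qed.

(** The main term of Stirling's formula for [fact_ratio] with N = m + 1; the terms in ln N combine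
    since (N + d) + (N - d) = 2 N. *)
Lemma growth_rate_frac N d : (d < N)%N ->
  2 * N%:R * growth_rate (d%:R / N%:R) =
  (N + d)%:R * ln (N + d)%:R + (N - d)%:R * ln (N - d)%:R
    - 2 * N%:R * ln N%:R :> R.
Proof.
move=> dN; have N0 : 0 < N%:R :> R by rewrite ltr0n; lia.
have nz : N%:R != 0 :> R by rewrite gt_eqF.
have e1 : 1 + d%:R / N%:R = (N + d)%:R / N%:R :> R by rewrite natrD; field.
have e2 : 1 - d%:R / N%:R = (N - d)%:R / N%:R :> R.
  by rewrite natrB ?(ltnW dN) //; field.
rewrite /growth_rate e1 e2 !ln_div ?posrE // ?ltr0n; [|lia|lia].
have e : (N + d)%:R + (N - d)%:R = 2 * N%:R :> R.
  by rewrite natrD natrB ?(ltnW dN) //; ring.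
rewrite -[X in _ = _ - X * _]e.
move: ((N + d)%:R) ((N - d)%:R) (ln _) (ln _) (ln _) => u v a b c.
by field.
Qed.

(** Replacing (m - d)! by (m + 1 - d)! / (m + 1 - d) leaves only factorials of N + d, N - d and N =
    m + 1, as [growth_rate_frac] requires. *)
Lemma ln_fact_ratio m d : (d <= m)%N ->
  ln (fact_ratio R m d) =
  ln ((m.+1 + d)`!%:R) + ln ((m.+1 - d)`!%:R) - ln ((m.+1 - d)%:R)
    - 2 * ln ((m.+1)`!%:R).
Proof.
move=> le_dm; rewrite /fact_ratio ln_div ?posrE ?ltr0n ?muln_gt0 ?expn_gt0 ?fact_gt0 //.
rewrite natrM lnM ?posrE ?ltr0n ?fact_gt0 // -mulnn natrM lnM ?posrE ?ltr0n ?fact_gt0 //.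
rewrite subSn // (factS (m - d)) (natrM _ (m - d).+1).
by rewrite (lnM (_ : (m - d).+1%:R \in _)) ?posrE ?ltr0n ?fact_gt0 //; ring.
Qed.

Lemma ln_fact_ratio_le m d : (d <= m)%N ->
  ln (fact_ratio R m d) <=
  2 * m.+1%:R * growth_rate (d%:R / m.+1%:R) + ln (m.+1 + d)%:R + 3.
Proof.
move=> le_dm; rewrite ln_fact_ratio // growth_rate_frac //.
have := @ln_fact_le (m.+1 + d) isT.
have := @ln_fact_le (m.+1 - d); rewrite subn_gt0 => /(_ le_dm).
have := ln_fact_ge m.+1.
have e : (m.+1 + d)%:R + (m.+1 - d)%:R = 2 * m.+1%:R :> R.
  by rewrite natrD natrB ?leqW //; ring.
rewrite -[(m.+1 + d).+1%:R]natr1 -[(m.+1 - d).+1%:R]natr1; lra.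
Qed.

Lemma ln_fact_ratio_ge m d : (d <= m)%N ->
  2 * m.+1%:R * growth_rate (d%:R / m.+1%:R) - 3 * ln m.+1%:R - 2 <=
  ln (fact_ratio R m d).
Proof.
move=> le_dm; rewrite ln_fact_ratio // growth_rate_frac //.
have := ln_fact_ge (m.+1 + d).
have := ln_fact_ge (m.+1 - d).
have := @ln_fact_le m.+1 isT.
have e : (m.+1 + d)%:R + (m.+1 - d)%:R = 2 * m.+1%:R :> R.
  by rewrite natrD natrB ?leqW //; ring.
have h : ln (m.+1 - d)%:R <= ln m.+1%:R :> R.
  by rewrite ler_ln ?posrE ?ltr0n ?ler_nat ?subn_gt0 ?leq_subr.
rewrite -[m.+2%:R]natr1; lra.
Qed.

End Stirling.

(** * Limits of the degree ratios and of the two rates *)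

Section Limits.
Variable R : realType.

Lemma cvg_inv_nat : (n%:R^-1 : R) @[n --> \oo] --> (0 : R).
Proof. by rewrite -cvg_shiftS; exact: cvg_harmonic. Qed.

(** Squeezed by 2 / sqrt n, because ln n = 2 ln (sqrt n) <= 2 sqrt n. *)
Lemma cvg_ln_div_nat : (ln n%:R / n%:R : R) @[n --> \oo] --> (0 : R).
Proof.
have h : (2 * Num.sqrt (n%:R^-1) : R) @[n --> \oo] --> (0 : R).
  rewrite -[X in _ --> X](mulr0 2); apply: cvgMr.
  rewrite -[X in _ --> X]sqrtr0; apply: continuous_cvg cvg_inv_nat.
  exact: sqrt_continuous.
apply: squeeze_cvgr (cvg_cst 0) h; near=> n.
have n0 : (0 < n)%N by near: n; exists 1%N.
have p0 : 0 < n%:R :> R by rewrite ltr0n.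
rewrite divr_ge0 ?ln_ge0 ?ler1n //= ler_pdivrMr //.
have s0 : 0 < Num.sqrt n%:R :> R by rewrite sqrtr_gt0.
have e : n%:R = Num.sqrt n%:R ^+ 2 :> R by rewrite sqr_sqrtr // ltW.
rewrite sqrtrV ?ltW //; set s := Num.sqrt _ in s0 e *.
rewrite e lnXn // -mulrA expr2 mulKf ?gt_eqF //.
by rewrite -(mulr_natl (ln s) 2) ltr_pM2l // ln_sublinear.
Unshelve. all: by end_near.
Qed.

Lemma growth_rate_continuous (alpha : R) : 0 < alpha -> alpha < 1 ->
  {for alpha, continuous (@growth_rate R)}.
Proof.
move=> a0 a1; rewrite /growth_rate.
have cD : {for alpha, continuous (fun x : R => 1 + x)}.
  by apply: cvgD; [exact: cvg_cst | exact: cvg_id].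
have cB : {for alpha, continuous (fun x : R => 1 - x)}.
  by apply: cvgB; [exact: cvg_cst | exact: cvg_id].
apply: cvgMl; apply: cvgD; apply: cvgM => //.
  by apply: (continuous_comp cD); apply: continuous_ln; lra.
by apply: (continuous_comp cB); apply: continuous_ln; lra.
Qed.

Lemma cvg_of_dist_inv (u : nat -> R) (l c : R) :
  (\forall n \near \oo, `|u n - l| <= c / n%:R) -> u n @[n --> \oo] --> l.
Proof.
move=> hu; have h0 : (c / n%:R : R) @[n --> \oo] --> (0 : R).
  by rewrite -[X in _ --> X](mulr0 c); apply: cvgMr; exact: cvg_inv_nat.
have hl : (l - c / n%:R : R) @[n --> \oo] --> l.
  by rewrite -[X in _ --> X]subr0; apply: cvgB h0; exact: cvg_cst.
have hr : (l + c / n%:R : R) @[n --> \oo] --> l.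
  by rewrite -[X in _ --> X]addr0; apply: cvgD h0; exact: cvg_cst.
apply: squeeze_cvgr hl hr; near=> n.
have : `|u n - l| <= c / n%:R by near: n.
by rewrite ler_distl.
Unshelve. all: by end_near.
Qed.

Section Degree.
Variables (alpha : R) (alpha_gt0 : 0 < alpha) (alpha_lt1 : alpha < 1).

Definition degree_bound n := Num.truncn (alpha * n%:R).

Lemma degree_boundP n : (degree_bound n)%:R <= alpha * n%:R < (degree_bound n)%:R + 1.
Proof.
by rewrite natr1; apply: truncn_itv; rewrite mulr_ge0 // ltW.
Qed.

Lemma degree_bound_lt n : (0 < n)%N -> (degree_bound n < n)%N.
Proof.
move=> n0; rewrite -(ltr_nat R); have /andP[h _] := degree_boundP n.
by apply: le_lt_trans h _; rewrite gtr_pMl ?ltr0n.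
Qed.

Lemma cvg_degree_bound : ((degree_bound n)%:R / n%:R : R) @[n --> \oo] --> alpha.
Proof.
apply: (@cvg_of_dist_inv _ _ 1); near=> n.
have n0 : (0 < n)%N by near: n; exists 1%N.
have p0 : 0 < n%:R :> R by rewrite ltr0n.
have /andP[h1 h2] := degree_boundP n.
rewrite -(@ler_pM2r _ n%:R) // divfK ?gt_eqF // -[X in _ * X]gtr0_norm // -normrM.
by rewrite mulrBl divfK ?gt_eqF // ler_norml; lra.
Unshelve. all: by end_near.
Qed.

Lemma degree_bound_gt0 : \forall n \near \oo, (0 < degree_bound n)%N.
Proof.
near=> n; rewrite truncn_gt0 -ler_pdivrMl // mulr1.
have : (Num.bound (alpha^-1) <= n)%N by near: n; exists (Num.bound (alpha^-1)).
rewrite -(ler_nat R); apply: le_trans.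
have a0 : 0 <= alpha^-1 by rewrite invr_ge0 ltW.
by have := archi_boundP a0 => /ltW.
Unshelve. all: by end_near.
Qed.

(** The predecessors reflect the lower bound, which uses a Gram polynomial of one degree less on one
    point fewer. *)
Lemma cvg_degree_bound_pred :
  ((degree_bound n).-1%:R / n.-1%:R : R) @[n --> \oo] --> alpha.
Proof.
apply: (@cvg_of_dist_inv _ _ 4); near=> n.
have n1 : (1 < n)%N by near: n; exists 2%N.
have k0 : (0 < degree_bound n)%N by near: n; apply: degree_bound_gt0.
have /andP[h1 h2] := degree_boundP n.
have n2 : 2 <= n%:R :> R by rewrite ler_nat.
have nP : n.-1%:R = n%:R - 1 :> R by rewrite -[in RHS](prednK (ltnW n1)) -natr1 addrK.
have kP : (degree_bound n).-1%:R = (degree_bound n)%:R - 1 :> R.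
  by rewrite -[in RHS](prednK k0) -natr1 addrK.
rewrite nP kP; have p0 : 0 < n%:R - 1 :> R by lra.
(* The truncation and the shift each contribute at most 1 to the numerator; 2 / (n - 1) <= 4 / n for
   n >= 2. *)
apply: (@le_trans _ _ (2 / (n%:R - 1))).
  rewrite -(@ler_pM2r _ (n%:R - 1)) // divfK ?gt_eqF // -[X in _ * X]gtr0_norm //.
  have [a0 a1] := (alpha_gt0, alpha_lt1).
  by rewrite -normrM mulrBl divfK ?gt_eqF // ler_norml mulrBr mulr1; lra.
rewrite ler_pdivrMr // mulrAC ler_pdivlMr; lra.
Unshelve. all: by end_near.
Qed.

Lemma cvg_upper_rate (c : R) :
  (growth_rate ((degree_bound n)%:R / n%:R) + 3 * (ln n%:R / n%:R) + c / n%:R : R)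
    @[n --> \oo] --> growth_rate alpha.
Proof.
have -> : growth_rate alpha = growth_rate alpha + 3 * 0 + c * 0.
  by rewrite !mulr0 !addr0.
apply: cvgD; last by apply: cvgMr; exact: cvg_inv_nat.
apply: cvgD; last by apply: cvgMr; exact: cvg_ln_div_nat.
apply: continuous_cvg cvg_degree_bound.
exact: growth_rate_continuous.
Qed.

(** The factor 1 - 1 / n is (n - 1) / n: the Gram polynomial lives on n - 1 points, while the
    logarithm is divided by n. *)
Lemma cvg_lower_rate (c : R) :
  (growth_rate ((degree_bound n).-1%:R / n.-1%:R) * (1 - n%:R^-1)
     - 4 * (ln n%:R / n%:R) - c / n%:R : R)
    @[n --> \oo] --> growth_rate alpha.
Proof.
have -> : growth_rate alpha = growth_rate alpha * (1 - 0) - 4 * 0 - c * 0.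
  by rewrite !mulr0 !subr0 mulr1.
apply: cvgB; last by apply: cvgMr; exact: cvg_inv_nat.
apply: cvgB; last by apply: cvgMr; exact: cvg_ln_div_nat.
apply: cvgM.
  apply: continuous_cvg cvg_degree_bound_pred.
  exact: growth_rate_continuous.
by apply: cvgB; [exact: cvg_cst | exact: cvg_inv_nat].
Qed.

End Degree.

(** Of the three logarithms of m + 1, two come from the square; the square root gives half of one
    from its linear factor and half from ln (m + 1 + d) <= ln (2 (m + 1)). *)
Lemma ln_upper_rate m d : (d <= m)%N ->
  ln (3 * m.+1%:R ^+ 2 * Num.sqrt (2 * m.+1%:R * fact_ratio R m d)) <=
  m.+1%:R * growth_rate (d%:R / m.+1%:R) + 3 * ln m.+1%:R + (ln 3 + ln 2 + 2).
Proof.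
move=> le_dm; have N0 : 0 < m.+1%:R :> R by [].
have r0 := fact_ratio_gt0 R m d.
have lnsqrt (x : R) : 0 < x -> 2 * ln (Num.sqrt x) = ln x.
  move=> x0; rewrite -[in RHS](sqr_sqrtr (ltW x0)) lnXn ?sqrtr_gt0 //.
  by rewrite mulr_natl.
have m0 : 0 < 2 * m.+1%:R :> R by rewrite mulr_gt0.
have s0 : 0 < 2 * m.+1%:R * fact_ratio R m d by rewrite mulr_gt0.
rewrite lnM ?posrE ?sqrtr_gt0 ?mulr_gt0 ?exprn_gt0 //.
rewrite lnM ?posrE ?exprn_gt0 // lnXn //.
have := lnsqrt _ s0; rewrite lnM ?posrE // (lnM (_ : 2 \in _)) ?posrE //.
have := ln_fact_ratio_le R le_dm.
have : ln (m.+1 + d)%:R <= ln 2 + ln m.+1%:R :> R.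
  rewrite -lnM ?posrE // ler_ln ?posrE ?ltr0n // -natrM ler_nat; lia.
rewrite -(mulr_natl (ln m.+1%:R) 2); lra.
Qed.

Lemma ln_lower_rate m d : (d <= m)%N ->
  m.+1%:R * growth_rate (d%:R / m.+1%:R) - 4 * ln m.+1%:R - (ln 4 + 1) <=
  ln (Num.sqrt (fact_ratio R m d) / (4 * m.+1%:R ^+ 2)).
Proof.
move=> le_dm; have N0 : 0 < m.+1%:R :> R by [].
have r0 := fact_ratio_gt0 R m d.
have e : 2 * ln (Num.sqrt (fact_ratio R m d)) = ln (fact_ratio R m d).
  rewrite -[in RHS](sqr_sqrtr (ltW r0)) lnXn ?sqrtr_gt0 //.
  by rewrite mulr_natl.
rewrite ln_div ?posrE ?sqrtr_gt0 ?mulr_gt0 ?exprn_gt0 //.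
rewrite lnM ?posrE ?exprn_gt0 // lnXn //.
have := ln_fact_ratio_ge R le_dm.
have : 0 <= ln m.+1%:R :> R by rewrite ln_ge0 // ler1n.
rewrite -(mulr_natl (ln m.+1%:R) 2); lra.
Qed.

End Limits.

(** * Supremum norms of complex polynomials *)

Section ComplexPolynomials.
Variable R : realType.
Implicit Types (x s : R) (p : {poly R[i]}) (q : {poly R}).
Local Notation normc := (@ComplexField.Normc.normc R).

Lemma normc_ge0 (z : R[i]) : 0 <= normc z.
Proof. by case: z => a b; apply: sqrtr_ge0. Qed.

Lemma normr_Re_le_normc (z : R[i]) : `|complex.Re z| <= normc z.
Proof.
case: z => a b /=; rewrite -sqrtr_sqr ler_wsqrtr // lerDl; exact: sqr_ge0.
Qed.

Lemma normc_real x : normc (x%:C)%C = `|x|.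
Proof. by rewrite /= expr0n /= addr0 sqrtr_sqr. Qed.

Lemma Re_mul_real (z : R[i]) x : complex.Re (z * (x%:C)%C) = complex.Re z * x.
Proof. by case: z => a b /=; rewrite mulr0 subr0. Qed.

Lemma rotate_to_real (z : R[i]) : exists2 w : R[i], normc w = 1 &
  complex.Re (w * z) = normc z.
Proof.
have [->|z0] := eqVneq z 0.
  by exists 1; rewrite ?ComplexField.Normc.normc1 // mulr0 ComplexField.Normc.normc0.
have nz : normc z != 0.
  by apply: contra_neq z0; apply: ComplexField.Normc.eq0_normc.
case: z z0 nz => a b _; set r := normc _ => nz.
have r2 : a ^+ 2 + b ^+ 2 = r ^+ 2 by rewrite sqr_sqrtr // addr_ge0 ?sqr_ge0.
exists (Complex (a / r) (- (b / r))) => /=.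
  rewrite sqrrN !expr_div_n -mulrDl r2 divff ?sqrtr1 //.
  by rewrite expf_neq0.
rewrite mulNr opprK mulrAC [b / r * b]mulrAC -mulrDl -!expr2 r2 expr2.
by rewrite mulfK.
Qed.

Lemma Re_horner_real (a : nat -> R[i]) n x :
  complex.Re (\sum_(i < n) a i * (x%:C)%C ^+ i) = \sum_(i < n) complex.Re (a i) * x ^+ i.
Proof.
elim: n => [|n IHn]; first by rewrite !big_ord0.
rewrite !big_ord_recr /= -IHn -rmorphXn /= -Re_mul_real.
by case: (\sum_(i < n) _) => u v; case: (_ * _).
Qed.

(** Reduction to real coefficients: on the real line q is the real part of w p, with w of modulus 1
    rotating p(s) onto its modulus. *)
Lemma real_poly_witness p s : exists q, [/\ (size q <= size p)%N,
  (forall x, `|q.[x]| <= normc p.[(x%:C)%C]) & `|q.[s]| = normc p.[(s%:C)%C]].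
Proof.
have [w nw hw] := rotate_to_real p.[(s%:C)%C].
pose q := \poly_(i < size p) complex.Re (w * p`_i).
have hq x : q.[x] = complex.Re (w * p.[(x%:C)%C]).
  rewrite horner_poly horner_coef mulr_sumr.
  under [in RHS]eq_bigr => i _ do rewrite mulrA.
  by rewrite (Re_horner_real (fun i => w * p`_i)).
exists q; split; first exact: size_poly.
  move=> x; rewrite hq; apply: le_trans (normr_Re_le_normc _) _.
  by rewrite ComplexField.Normc.normcM nw mul1r.
by rewrite hq hw ger0_norm // normc_ge0.
Qed.

End ComplexPolynomials.

(** * Transfer from the indices {0, ..., m} to the grid in [-1, 1] *)

Section SupNorms.
Variable R : realType.
Implicit Types (x s : R) (p : {poly R[i]}) (q : {poly R}).
Local Notation normc := (@ComplexField.Normc.normc R).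

Lemma grid_pointE m i : (0 < m)%N ->
  grid_point R m.+1 i.+1 = (2 * i%:R - m%:R) / m%:R.
Proof. by move=> m0; rewrite /grid_point -!natr1 addrK; congr (_ / _); ring. Qed.

Lemma normc_le_supnorm_grid p m i : (0 < m)%N -> (i <= m)%N ->
  normc p.[(((2 * i%:R - m%:R) / m%:R)%:C)%C] <= supnorm (grid R m.+1) p.
Proof.
move=> m0 le_im; apply: ub_le_sup.
  (* The real [sup] dominates its set only if the set is bounded; a sum of nonnegative values bounds
     each of them. *)
  exists (\sum_(k < m.+2) normc p.[((grid_point R m.+1 k)%:C)%C]).
  move=> _ [_ [k /= /andP[_ km] <-] <-].
  rewrite (bigD1 (Ordinal (km : (k < m.+2)%N))) //= lerDl.
  by apply: sumr_ge0 => j _; apply: normc_ge0.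
exists ((2 * i%:R - m%:R) / m%:R) => //; exists i.+1; first by rewrite /= ltnS.
by rewrite grid_pointE.
Qed.

Definition upper_factor m d : R :=
  3 * m.+1%:R ^+ 2 * Num.sqrt (2 * m.+1%:R * fact_ratio R m d).

Lemma upper_factor_gt0 m d : 0 < upper_factor m d.
Proof. by rewrite !mulr_gt0 ?sqrtr_gt0 ?mulr_gt0 ?fact_ratio_gt0. Qed.

Lemma normc_le_grid p m d s : (0 < m)%N -> (d <= m)%N -> (size p <= d.+1)%N ->
  -1 <= s <= 1 -> normc p.[(s%:C)%C] <= supnorm (grid R m.+1) p * upper_factor m d.
Proof.
move=> m0 le_dm sp /andP[s1 s2].
have p0 : 0 < m%:R :> R by rewrite ltr0n.
have [q [sq le_q <-]] := real_poly_witness p s.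
(* [r] is [q] in the index variable: x in [0, m] stands for (2 x - m) / m in [-1, 1]. *)
pose r := q \Po ((2 / m%:R) *: 'X - 1%:P).
have hr x : r.[x] = q.[(2 * x - m%:R) / m%:R].
  rewrite horner_comp !hornerE; congr _.[_]; field; exact: lt0r_neq0.
have sr : (size r <= d.+1)%N.
  apply: leq_trans (size_comp_poly_leq _ _) _.
  have -> : size ((2 / m%:R) *: 'X - 1%:P : {poly R}) = 2%N.
    have nz : 2 / m%:R != 0 :> R by rewrite mulf_neq0 ?invr_eq0 ?gt_eqF.
    by rewrite size_polyDl size_scale ?size_polyX // size_polyN size_poly1.
  by rewrite muln1 ltnS -subn1 leq_subLR add1n (leq_trans sq).
have hs : q.[s] = r.[m%:R / 2 * (1 + s)].
  by rewrite hr; congr _.[_]; field; exact: lt0r_neq0.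
rewrite hs; apply: (poly_grid_bound le_dm sr).
  move=> i le_im; rewrite hr; apply: le_trans (le_q _) _.
  exact: normc_le_supnorm_grid.
by apply/andP; split; nra.
Qed.

Lemma supnorm_grid_ge0 p m : (0 < m)%N -> 0 <= supnorm (grid R m.+1) p.
Proof.
by move=> m0; apply: le_trans (normc_le_supnorm_grid p m0 (leq0n m)); apply: normc_ge0.
Qed.

Lemma ratio_le_upper_factor p m d : (0 < m)%N -> (d <= m)%N -> (size p <= d.+1)%N ->
  supnorm `[-1, 1]%classic p / supnorm (grid R m.+1) p <= upper_factor m d.
Proof.
(* If the grid norm is 0, the quotient is 0 by the convention for division and the bound holds
   trivially. *)
move=> m0 le_dm sp; have := supnorm_grid_ge0 p m0; rewrite le_eqVlt => /predU1P[<-|g0].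
  by rewrite invr0 mulr0 ltW // upper_factor_gt0.
rewrite ler_pdivrMr // mulrC; apply: ge_sup.
  by exists (normc p.[(0%:C)%C]), 0 => //; rewrite /= in_itv /=; apply/andP; split; lra.
by move=> _ [s /= hs <-]; apply: normc_le_grid; rewrite // -in_itv.
Qed.

Lemma exists_ratio_ge m d : (d <= m)%N -> exists p, [/\ p != 0, (size p <= d.+2)%N &
  Num.sqrt (fact_ratio R m d) / (4 * m.+1%:R ^+ 2) <=
    supnorm `[-1, 1]%classic p / supnorm (grid R m.+2) p].
Proof.
move=> le_dm; have [q [A [sq A0 le_q ge_q]]] := poly_grid_example R le_dm.
set L := _ / _ in ge_q *.
have L0 : 0 < L by rewrite divr_gt0 ?sqrtr_gt0 ?fact_ratio_gt0 ?mulr_gt0 ?exprn_gt0.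
have p0 : 0 < m.+1%:R :> R by [].
pose t : {poly R} := (m.+1%:R / 2) *: ('X + 1%:P).
pose p : {poly R[i]} := map_poly (real_complex R) (q \Po t).
have hp s : p.[(s%:C)%C] = (q.[m.+1%:R / 2 * (s + 1)]%:C)%C.
  by rewrite horner_map horner_comp !hornerE.
have sp : (size p <= d.+2)%N.
  rewrite size_map_poly; apply: leq_trans (size_comp_poly_leq _ _) _.
  have -> : size t = 2%N.
    by rewrite size_scale ?size_XaddC // mulf_neq0 ?invr_eq0 ?gt_eqF.
  by rewrite muln1 ltnS -subn1 leq_subLR add1n.
(* The point of [-1, 1] whose index is 1 / 2. *)
pose s0 : R := m.+1%:R^-1 - 1.
have s0_in : -1 <= s0 <= 1.
  have i0 : 0 <= m.+1%:R^-1 :> R by [].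
  have i1 : m.+1%:R^-1 <= 1 :> R by rewrite invf_le1 // ler1n.
  by rewrite /s0; move: (m.+1%:R^-1) i0 i1 => u u0 u1; apply/andP; split; lra.
have ps0 : normc p.[(s0%:C)%C] = `|q.[2^-1]|.
  rewrite hp normc_real /s0 subrK (_ : _ * _ = 2^-1) //.
  by move: (m.+1%:R) p0 => u /lt0r_neq0 nu; field.
have pos : 0 < normc p.[(s0%:C)%C].
  by rewrite ps0; apply: lt_le_trans ge_q; rewrite mulr_gt0.
have nz : p != 0.
  by apply: contraTneq pos => ->; rewrite horner0 ComplexField.Normc.normc0 ltxx.
exists p; split=> //.
(* The upper bound serves twice: it makes the grid norm nonzero, and it bounds the values on [-1, 1]
   as [sup] demands. *)
have upper s : -1 <= s <= 1 ->
    normc p.[(s%:C)%C] <= supnorm (grid R m.+2) p * upper_factor m.+1 d.+1.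
  by apply: normc_le_grid.
have g0 : 0 < supnorm (grid R m.+2) p.
  by rewrite -(pmulr_lgt0 _ (upper_factor_gt0 m.+1 d.+1)) (lt_le_trans pos) ?upper.
have gA : supnorm (grid R m.+2) p <= A.
  apply: ge_sup.
    by exists (normc p.[((grid_point R m.+2 1)%:C)%C]), (grid_point R m.+2 1) => //; exists 1%N.
  move=> _ [_ [[|k] //= km <-] <-].
  rewrite grid_pointE // hp normc_real.
  rewrite (_ : _ * _ = k%:R); first exact: le_q.
  by move: (m.+1%:R) p0 => u /lt0r_neq0 nu; field.
rewrite ler_pdivlMr //; apply: (@le_trans _ _ (A * L)).
  by rewrite mulrC ler_pM2r.
apply: le_trans ge_q _; rewrite -ps0; apply: ub_le_sup.
  exists (supnorm (grid R m.+2) p * upper_factor m.+1 d.+1).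
  by move=> _ [s /= hs <-]; apply: upper; move: hs; rewrite in_itv.
by exists s0 => //=; rewrite in_itv.
Qed.

End SupNorms.

(** * Squeeze of the normalized logarithm between the two rates *)

Theorem theorem1p1 (R : realType) (alpha : R)
    (alpha_gt0 : 0 < alpha) (alpha_lt1 : alpha < 1) :
  ((n%:R^-1)%:E * lne (max_ratio alpha n))%E @[n --> \oo]
    --> (growth_rate alpha)%:E.
Proof.
pose lo n : R := growth_rate ((degree_bound alpha n).-1%:R / n.-1%:R) * (1 - n%:R^-1)
     - 4 * (ln n%:R / n%:R) - (ln 4 + 1) / n%:R.
pose hi n : R := growth_rate ((degree_bound alpha n)%:R / n%:R)
     + 3 * (ln n%:R / n%:R) + (ln 3 + ln 2 + 2) / n%:R.
apply: (@squeeze_cvge _ _ _ _ (EFin \o lo) _ (EFin \o hi)); last first.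
- apply: cvg_EFin; first exact: nearW.
  exact: cvg_upper_rate.
- apply: cvg_EFin; first exact: nearW.
  exact: cvg_lower_rate.
near=> n.
have k0 : (0 < degree_bound alpha n)%N by near: n; apply: degree_bound_gt0.
have n1 : (1 < n)%N by near: n; exists 2%N.
have kn : (degree_bound alpha n < n)%N by apply: degree_bound_lt => //; apply: ltnW.
have /andP[kle _] := degree_boundP alpha_gt0 n.
have N0 : 0 < n%:R :> R by rewrite ltr0n ltnW.
have Ni : 0 < n%:R^-1 :> R by rewrite invr_gt0.
have en : n.-2.+2 = n by rewrite -[RHS](prednK (ltnW n1)) -[in RHS](prednK (_ : 0 < n.-1)%N) //; lia.
have le_up : (max_ratio alpha n <= (upper_factor R n.-1 (degree_bound alpha n))%:E)%E.
  apply: ge_ereal_sup => _ [p [_ sp] <-]; rewrite lee_fin.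
  have sk : ((size p).-1 <= degree_bound alpha n)%N.
    by rewrite truncn_ge_nat // mulr_ge0 // ltW.
  rewrite -[X in grid R X](prednK (ltnW n1)); apply: ratio_le_upper_factor; lia.
(* The factor x of the example costs one degree and one grid point: the Gram polynomial lives on n -
   1 points, that is m = n - 2. *)
set lf : R := Num.sqrt (fact_ratio R n.-2 (degree_bound alpha n).-1) / (4 * n.-2.+1%:R ^+ 2).
have ge_lo : (lf%:E <= max_ratio alpha n)%E.
  have le_k : ((degree_bound alpha n).-1 <= n.-2)%N by lia.
  have [p [p0 sp ge_p]] := exists_ratio_ge R le_k.
  rewrite en in ge_p.
  apply: (@le_trans _ _ (supnorm `[-1, 1]%classic p / supnorm (grid R n) p)%:E).
    by rewrite lee_fin.
  apply: ereal_sup_ubound; exists p => //; split=> //.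
  apply: le_trans kle; rewrite ler_nat; lia.
have U0 := upper_factor_gt0 R n.-1 (degree_bound alpha n).
have L0 : 0 < lf by rewrite divr_gt0 ?sqrtr_gt0 ?fact_ratio_gt0 ?mulr_gt0 ?exprn_gt0.
(* The two finite bounds make the supremum a real number, positive by [L0], so that [lne] becomes
   [ln]. *)
have [r er] : exists r, max_ratio alpha n = r%:E.
  case: (max_ratio alpha n) le_up ge_lo => [r| |] //; by exists r.
rewrite er !lee_fin in le_up ge_lo.
have r0 : 0 < r by apply: lt_le_trans ge_lo.
rewrite er lne_EFin // -EFinM /= !lee_fin; apply/andP; split.
  have le_k : ((degree_bound alpha n).-1 <= n.-2)%N by lia.
  have := ln_lower_rate R le_k; rewrite -/lf.
  have : ln lf <= ln r by rewrite ler_ln ?posrE.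
  have : ln n.-2.+1%:R <= ln n%:R :> R.
    by rewrite ler_ln ?posrE ?ltr0n // ?ler_nat; lia.
  have -> : n.-2.+1 = n.-1 by lia.
  move=> h1 h2 h3; rewrite /lo ler_pdivlMl //.
  have eP : n.-1%:R = n%:R - 1 :> R by rewrite -[in RHS](prednK (ltnW n1)) -natr1 addrK.
  rewrite {1}eP in h3.
  set g := growth_rate _ in h3 *.
  have -> : n%:R * (g * (1 - n%:R^-1) - 4 * (ln n%:R / n%:R) - (ln 4 + 1) / n%:R)
     = (n%:R - 1) * g - 4 * ln n%:R - (ln 4 + 1).
    by field; exact: lt0r_neq0.
  lra.
have le_k : (degree_bound alpha n <= n.-1)%N by lia.
have := ln_upper_rate R le_k.
rewrite -/(upper_factor R n.-1 (degree_bound alpha n)) (prednK (ltnW n1)).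
have : ln r <= ln (upper_factor R n.-1 (degree_bound alpha n)) by rewrite ler_ln ?posrE.
move=> h1 h2; rewrite /hi ler_pdivrMl //.
set g := growth_rate _ in h2 *.
have -> : n%:R * (g + 3 * (ln n%:R / n%:R) + (ln 3 + ln 2 + 2) / n%:R)
     = n%:R * g + 3 * ln n%:R + (ln 3 + ln 2 + 2).
  by field; exact: lt0r_neq0.
exact: le_trans h2.
Unshelve. all: by end_near.
Qed.
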